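(* Let $\{\mathcal{I},F,\{f_i\}_{i=1}^N,\{\Delta_i\}_{i=1}^N\}$ be the branching function system associated to a slow continued fraction algorithm, let $E=\bigcup_{i=j}^k\Delta_i$ for some $1\le j\le k\le N$ with $E\neq\mathcal{I}$, and let $G=G(F,E)$ be the jump transformation of $F$ induced on $E$, with inverse branches $\{g_j\}_{j\in\mathbb{N}}$. Then there is a unital embedding $\varphi:\mathcal{O}_\infty\to\mathcal{O}_N$ which is compatible with the representations $\pi_F:\mathcal{O}_N\to B(\ell^2(\mathcal{I}))$ and $\pi_G:\mathcal{O}_\infty\to B(\ell^2(\mathcal{I}_E))$ in the sense that $\ell^2(\mathcal{I}_E)$ sits inside $\ell^2(\mathcal{I})$ as a closed, invariant subspace (for $\pi_F$) on which $$\pi_F\circ\varphi=\pi_G.$$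
   Context: $\mathcal{O}_N$ ($2\le N<\infty$) is the universal $C^*$-algebra generated by $S_1,\dots,S_N$ with $S_i^*S_j=\delta_{ij}1$, $\sum_{i=1}^N S_iS_i^*=1$; $\mathcal{O}_\infty$ is the universal unital $C^*$-algebra generated by $\{T_j\}_{j\in\mathbb{N}}$ with $T_i^*T_j=\delta_{ij}1$ and $\sum_{j=1}^nT_jT_j^*\le1$ for all $n$. An embedding is an injective $*$-homomorphism. A branching function system (BFS) of order $N\in\{2,3,\dots,\infty\}$ on a set $\Omega$ is a family of injective maps $f_i:\Omega\to\Omega$ ($1\le i\le N$, or $i\in\mathbb{N}$ if $N=\infty$) with pairwise disjoint ranges $\Delta_i=f_i(\Omega)$ whose union is $\Omega$; $F:\Omega\to\Omega$ is the map equal to $f_i^{-1}$ on $\Delta_i$. It induces a representation $\pi_F$ of $\mathcal{O}_N$ on $\ell^2(\Omega)$ (with orthonormal basis $\{e_\omega:\omega\in\Omega\}$) sending the $i$-th generator to the isometry $e_\omega\mapsto e_{f_i(\omega)}$. $\mathrm{PGL}_2(\mathbb{Z})$ is the group of $2\times2$ integer matrices of determinant $\pm1$ modulo $\pm$ identity, viewed as fractional linear transformations. A unimodular interval is $[\frac pq,\frac{p'}{q'}]\subset[0,1]$ with reduced fractions satisfying $pq'-p'q=-1$. A unimodular partition is a finite collection of unimodular intervals with union $[0,1]$, any two of which meet in at most one point. A slow continued fraction algorithm (SCFA) is a finite collection $h_1,\dots,h_N:[0,1]\to[0,1]$ ($N\ge2$) of fractional linear transformations in $\mathrm{PGL}_2(\mathbb{Z})$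 whose images $h_i([0,1])$ form a unimodular partition, indexed from left to right. Let $\mathcal{I}=[0,1]\setminus\mathbb{Q}$; the BFS associated to the SCFA is the BFS on $\mathcal{I}$ formed by the restrictions $f_i=h_i|_{\mathcal{I}}$. Jump transformation: with $E$ as in the claim, $\mathcal{I}_E=\{x\in\mathcal{I}:F^n(x)\in E\text{ for infinitely many }n\in\mathbb{N}\}$, $r(x)=\inf\{n\in\mathbb{N}\cup\{0\}:F^n(x)\in E\}$ for $x\in\mathcal{I}_E$, and $G(F,E):\mathcal{I}_E\to\mathcal{I}_E$, $G(F,E)(x)=F^{r(x)+1}(x)$. For $E\ne\mathcal{I}$, the inverse branches of $G$ are the countably infinitely many maps $g_j:\mathcal{I}_E\to\mathcal{I}_E$ given by the restrictions of compositions $f_{i_1}\circ\cdots\circ f_{i_k}$ ($k\ge1$) with $\Delta_{i_k}\subset E$ and $\Delta_{i_1},\dots,\Delta_{i_{k-1}}$ disjoint from $E$, enumerated (in any fixed way) by $j\in\mathbb{N}$; they form a BFS of order $\infty$ on $\mathcal{I}_E$, and $\pi_G$ is the representation of $\mathcal{O}_\infty$ it induces. The inclusion $\mathcal{I}_E\subset\mathcal{I}$ gives $\ell^2(\mathcal{I}_E)\subset\ell^2(\mathcal{I})$. *)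

(* Defs.v *)
From HB Require Import structures.
From mathcomp Require Import all_boot all_order all_algebra.
From mathcomp Require Import complex ring lra.
From mathcomp Require Import all_classical all_reals all_analysis.

Set Implicit Arguments.
Unset Strict Implicit.
Unset Printing Implicit Defensive.

Import Order.TTheory GRing.Theory Num.Theory.
Import numFieldNormedType.Exports.

Local Open Scope classical_set_scope.
Local Open Scope ring_scope.
Local Open Scope complex_scope.

(* Unital C*-algebras over C = R[i].  An [algType] is a nonzero ring, so the
   zero C*-algebra is excluded.  The norm is a separate R-valued operation,
   because the ring structures and the normed modules of the libraries cannot be
   joined on one carrier. *)
HB.mixin Record isCStar (R : realType) A & GRing.Algebra R[i] A := {
  cnorm : A -> R;
  cnorm0_eq0 : forall x : A, cnorm x = 0 -> x = 0;
  cnormD_le : forall x y : A, cnorm (x + y) <= cnorm x + cnorm y;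
  cnormZ : forall (c : R[i]) (x : A), cnorm (c *: x) = Normc.normc c * cnorm x;
  cnormM_le : forall x y : A, cnorm (x * y) <= cnorm x * cnorm y;
  cnorm_complete : forall u : nat -> A,
    (forall e : R, 0 < e -> exists n0 : nat, forall m n : nat,
       (n0 <= m)%N -> (n0 <= n)%N -> cnorm (u m - u n) < e) ->
    exists l : A, forall e : R, 0 < e -> exists n0 : nat, forall n : nat,
       (n0 <= n)%N -> cnorm (u n - l) < e;
  star : A -> A;
  starK : involutive star;
  starD : forall x y : A, star (x + y) = star x + star y;
  starZ : forall (c : R[i]) (x : A), star (c *: x) = c^* *: star x;
  starM : forall x y : A, star (x * y) = star y * star x;
  cstar_identity : forall x : A, cnorm (star x * x) = cnorm x ^+ 2
}.

#[short(type="cstarType")]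
HB.structure Definition CStar (R : realType) :=
  {A of GRing.Algebra R[i] A & isCStar R A}.

Section CStarDefs.
Context {R : realType}.

Record is_unital_star_hom (A B : cstarType R) (phi : A -> B) : Prop := {
  ush_linear : forall (c : R[i]) (x y : A), phi (c *: x + y) = c *: phi x + phi y;
  ush_mul : forall x y : A, phi (x * y) = phi x * phi y;
  ush_one : phi 1 = 1;
  ush_star : forall x : A, phi (star x) = star (phi x)
}.

Definition is_unital_embedding (A B : cstarType R) (phi : A -> B) : Prop :=
  is_unital_star_hom phi /\ injective phi.

(* The order of a C*-algebra: positive elements are those of the form z^* z. *)
Definition cle (A : cstarType R) (x y : A) : Prop :=
  exists z : A, y - x = star z * z.

Record is_closed_star_subalgebra (A : cstarType R) (D : set A) : Prop := {
  css_one : D 1;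
  css_linear : forall (c : R[i]) (x y : A), D x -> D y -> D (c *: x + y);
  css_mul : forall x y : A, D x -> D y -> D (x * y);
  css_star : forall x : A, D x -> D (star x);
  css_closed : forall x : A,
    (forall e : R, 0 < e -> exists2 y : A, D y & cnorm (x - y) < e) -> D x
}.

Definition generated_by (J : Type) (A : cstarType R) (s : J -> A) : Prop :=
  forall D : set A, is_closed_star_subalgebra D -> (forall j, D (s j)) ->
  D = setT.

(* [(A, s)] is the universal unital C*-algebra generated by a family indexed by
   [J] subject to the relations [rel].  The morphism given by the universal
   property is unique because [s] generates [A]. *)
Record is_universal (J : Type) (rel : forall B : cstarType R, (J -> B) -> Prop)
    (A : cstarType R) (s : J -> A) : Prop := {
  univ_rel : rel A s;
  univ_gen : generated_by s;
  univ_ext : forall (B : cstarType R) (t : J -> B), rel B t ->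
    exists psi : A -> B, is_unital_star_hom psi /\ forall j, psi (s j) = t j
}.

Definition cuntz_rel (N : nat) (B : cstarType R) (s : 'I_N -> B) : Prop :=
  (forall i j, star (s i) * s j = (i == j)%:R) /\
  \sum_(i < N) s i * star (s i) = 1.

Definition cuntz_inf_rel (B : cstarType R) (t : nat -> B) : Prop :=
  (forall i j, star (t i) * t j = (i == j)%:R) /\
  (forall n : nat, cle (\sum_(j < n) t j * star (t j)) 1).

Definition is_cuntz (N : nat) (A : cstarType R) (s : 'I_N -> A) : Prop :=
  is_universal (@cuntz_rel N) s.

Definition is_cuntz_inf (A : cstarType R) (t : nat -> A) : Prop :=
  is_universal cuntz_inf_rel t.

End CStarDefs.

Section SquareSummable.
Context {R : realType} {T : choiceType}.
Implicit Types f g : T -> R[i].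

Definition sqsum f : \bar R :=
  \esum_(t in [set: T]) (Normc.normc (f t) ^+ 2)%:E.

Definition sq_summable : {pred T -> R[i]} := fun f => (sqsum f < +oo)%E.

Lemma normc_ge0 (z : R[i]) : 0 <= Normc.normc z.
Proof. by case: z => a b /=; exact: sqrtr_ge0. Qed.

Lemma sqsum_ge0 f : (0 <= sqsum f)%E.
Proof. by apply: esum_ge0 => t _; rewrite lee_fin sqr_ge0. Qed.

Lemma sqsum_fin f : f \in sq_summable -> sqsum f = (fine (sqsum f))%:E.
Proof.
by move=> fs; rewrite fineK// ge0_fin_numE//; exact: sqsum_ge0.
Qed.

Lemma esumZ_le (c : R) (a : T -> R) : 0 <= c -> (forall t, 0 <= a t) ->
  (\esum_(t in [set: T]) (c * a t)%:E <= c%:E * \esum_(t in [set: T]) (a t)%:E)%E.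
Proof.
move=> c0 a0; apply: ge_ereal_sup => _ [F [finF _]] <-.
rewrite (eq_fsbigr (fun t => c%:E * (a t)%:E)%E); last by move=> t _; rewrite EFinM.
rewrite -ge0_mule_fsumr; last by move=> t; rewrite lee_fin.
by rewrite lee_wpmul2l// esum_ge//; exists F.
Qed.

Lemma sqsum0 : sqsum (fun=> 0) = 0%E.
Proof. by apply: esum1 => t _; rewrite Normc.normc0 expr0n. Qed.

Lemma sqsumZ_le (c : R[i]) f :
  (sqsum (c *: f) <= (Normc.normc c ^+ 2)%:E * sqsum f)%E.
Proof.
rewrite /sqsum; under eq_esum => t _ do rewrite Normc.normcM exprMn.
by apply: esumZ_le => [|t]; exact: sqr_ge0.
Qed.

Lemma sqsumZ (c : R[i]) f : sqsum (c *: f) = ((Normc.normc c ^+ 2)%:E * sqsum f)%E.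
Proof.
apply/eqP; rewrite eq_le sqsumZ_le/=.
have [->|c0] := eqVneq c 0.
  by rewrite Normc.normc0 expr0n/= mul0e sqsum_ge0.
have nc0 : Normc.normc c ^+ 2 != 0.
  by rewrite expf_neq0//; apply: contra c0 => /eqP/Normc.eq0_normc ->.
have {1}-> : f = c^-1 *: (c *: f) by rewrite scalerA mulVf// scale1r.
apply: (@le_trans _ _ ((Normc.normc c ^+ 2)%:E *
    ((Normc.normc c^-1 ^+ 2)%:E * sqsum (c *: f)))%E).
  by rewrite lee_wpmul2l ?lee_fin ?sqr_ge0// sqsumZ_le.
by rewrite muleA -EFinM Normc.normcV exprVn mulfV// mul1e.
Qed.

Lemma sqsumD_le (s : R) f g : 0 < s < 1 ->
  (sqsum (f + g)%R <= (s^-1)%:E * sqsum f + ((1 - s)^-1)%:E * sqsum g)%E.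
Proof.
move=> /andP[s0 s1]; have s1' : 0 < 1 - s by rewrite subr_gt0.
apply: (@le_trans _ _ (\esum_(t in [set: T])
    ((s^-1 * Normc.normc (f t) ^+ 2)%:E + ((1 - s)^-1 * Normc.normc (g t) ^+ 2)%:E))%E).
  apply: le_esum => t _; rewrite -EFinD lee_fin.
  set a := Normc.normc (f t); set b := Normc.normc (g t).
  have ab : Normc.normc ((f + g) t) ^+ 2 <= (a + b) ^+ 2.
    by rewrite ler_sqr ?nnegrE ?addr_ge0 ?normc_ge0// le_normcD.
  apply: le_trans ab _; rewrite -subr_ge0.
  have -> : s^-1 * a ^+ 2 + (1 - s)^-1 * b ^+ 2 - (a + b) ^+ 2 =
      ((1 - s) * a - s * b) ^+ 2 * (s^-1 * (1 - s)^-1).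
    by field; rewrite !gt_eqF.
  by rewrite mulr_ge0 ?sqr_ge0// mulr_ge0// invr_ge0 ltW.
rewrite esumD; last 2 first.
- by move=> t _; rewrite lee_fin mulr_ge0 ?sqr_ge0// invr_ge0 ltW.
- by move=> t _; rewrite lee_fin mulr_ge0 ?sqr_ge0// invr_ge0 ltW.
by apply: leeD; apply: esumZ_le => [|t]; rewrite ?sqr_ge0// invr_ge0 ltW.
Qed.

Lemma sq_summable_submod : submod_closed sq_summable.
Proof.
split=> [|c f g fs gs].
  by rewrite -topredE/= /sq_summable sqsum0 ltry.
have h2 : 0 < (2^-1 : R) < 1 by apply/andP; split; lra.
rewrite -topredE/= /sq_summable; apply: le_lt_trans (@sqsumD_le 2^-1 _ _ h2) _.
rewrite sqsumZ (sqsum_fin fs) (sqsum_fin gs).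
by rewrite -!EFinM -EFinD ltry.
Qed.

HB.instance Definition _ :=
  GRing.isSubmodClosed.Build R[i] (T -> R[i]) sq_summable sq_summable_submod.

End SquareSummable.

Record l2 (R : realType) (T : choiceType) : Type := L2 {
  l2fun :> T -> R[i];
  _ : l2fun \in @sq_summable R T
}.

Section L2.
Context {R : realType} {T : choiceType}.

HB.instance Definition _ := [isSub for @l2fun R T].
HB.instance Definition _ := [Choice of l2 R T by <:].
HB.instance Definition _ := [SubChoice_isSubLmodule of l2 R T by <:].

Lemma l2_sqsum (f : l2 R T) : sqsum f = (fine (sqsum f))%:E.
Proof. exact: sqsum_fin (valP f). Qed.

Lemma l2_fine_ge0 (f : l2 R T) : 0 <= fine (sqsum f).
Proof. by rewrite fine_ge0// sqsum_ge0. Qed.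

Definition l2norm (f : l2 R T) : R := Num.sqrt (fine (sqsum f)).

Lemma l2norm_sqr (f : l2 R T) : l2norm f ^+ 2 = fine (sqsum f).
Proof. by rewrite sqr_sqrtr// l2_fine_ge0. Qed.

Lemma l2norm_ge0 (f : l2 R T) : 0 <= l2norm f.
Proof. exact: sqrtr_ge0. Qed.

Lemma l2norm0_eq0 (f : l2 R T) : l2norm f = 0 -> f = 0.
Proof.
move=> f0; apply/val_inj/funext => t /=.
apply: Normc.eq0_normc; apply/eqP; rewrite -sqrf_eq0 eq_le sqr_ge0 andbT.
rewrite -lee_fin; apply: (@le_trans _ _ (sqsum f)).
  rewrite -(@esum_set1 _ _ t (fun t => (Normc.normc (f t) ^+ 2)%:E)) ?lee_fin ?sqr_ge0//.
  rewrite [leLHS]esum_mkcond; apply: le_esum => u _.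
  by case: ifP => // _; rewrite lee_fin sqr_ge0.
by rewrite l2_sqsum -l2norm_sqr f0 expr0n.
Qed.

Lemma l2normZ (c : R[i]) (f : l2 R T) :
  l2norm (c *: f) = Normc.normc c * l2norm f.
Proof.
rewrite /l2norm (_ : sqsum (c *: f)%R = sqsum (c *: (f : T -> R[i]))%R)//.
rewrite sqsumZ l2_sqsum -EFinM /= sqrtrM ?sqr_ge0//.
by rewrite sqrtr_sqr ger0_norm// normc_ge0.
Qed.

Lemma l2normD_le (f g : l2 R T) : l2norm (f + g) <= l2norm f + l2norm g.
Proof.
have [f0|f0] := eqVneq (l2norm f) 0.
  by rewrite f0 (l2norm0_eq0 f0) !add0r.
have [g0|g0] := eqVneq (l2norm g) 0.
  by rewrite g0 (l2norm0_eq0 g0) !addr0.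
have {}f0 : 0 < l2norm f by rewrite lt_def f0 l2norm_ge0.
have {}g0 : 0 < l2norm g by rewrite lt_def g0 l2norm_ge0.
rewrite -(@ler_sqr _ (l2norm (f + g))) ?nnegrE ?addr_ge0 ?l2norm_ge0//.
set x := l2norm f; set y := l2norm g.
have s01 : 0 < x / (x + y) < 1.
  by rewrite divr_gt0 ?addr_gt0//= ltr_pdivrMr ?addr_gt0// mul1r ltrDl.
have := @sqsumD_le R T _ f g s01.
rewrite (_ : sqsum (_ + _)%R = sqsum (f + g)%R)//.
rewrite (l2_sqsum (f + g)) (l2_sqsum f) (l2_sqsum g) -!l2norm_sqr -!EFinM -EFinD lee_fin => /le_trans; apply.
rewrite le_eqVlt; apply/orP; left; apply/eqP; rewrite -/x -/y.
by field; rewrite (addrC x y) addrK !gt_eqF ?addr_gt0.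
Qed.

Let nrm (f : l2 R T) : R[i] := (l2norm f)%:C.

Let nrmD f g : nrm (f + g) <= nrm f + nrm g.
Proof. by rewrite /nrm -rmorphD/= lecR l2normD_le. Qed.

Let nrmZ (c : R[i]) f : nrm (c *: f) = `|c| * nrm f.
Proof. by rewrite /nrm l2normZ rmorphM; congr (_ * _); case: c. Qed.

Let nrm0 f : nrm f = 0 -> f = 0.
Proof. by move=> /complexI /l2norm0_eq0. Qed.

HB.instance Definition _ :=
  Lmodule_isNormed.Build R[i] (l2 R T) nrmD nrmZ nrm0.

Lemma l2_normE (f : l2 R T) : `|f| = (l2norm f)%:C.
Proof. by []. Qed.

(* Meaningful for absolutely summable families only: the sum of the positive
   parts minus the sum of the negative parts, as [\esum] sums nonnegative
   families. *)
Definition rsum (v : T -> R) : R :=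
  fine (esum [set: T] (EFin \o v)^\+ - esum [set: T] (EFin \o v)^\-)%E.

Definition csum (u : T -> R[i]) : R[i] :=
  rsum (fun t => complex.Re (u t)) +i* rsum (fun t => complex.Im (u t)).

Definition l2inner (f g : l2 R T) : R[i] := csum (fun t => f t * (g t)^*).

Lemma l2inner_norm (f : l2 R T) : l2inner f f = `|f| ^+ 2.
Proof.
rewrite l2_normE -rmorphXn/= l2norm_sqr /l2inner /csum.
have h t : f t * (f t)^* = (Normc.normc (f t) ^+ 2)%:C.
  case: (f t) => a b /=; rewrite sqr_sqrtr ?addr_ge0 ?sqr_ge0//.
  by apply/eqP; rewrite eq_complex/=; apply/andP; split; apply/eqP; ring.
have zz : rsum (fun=> 0) = 0.
  rewrite /rsum !esum1 ?sube0// => t _ /=.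
    by rewrite funenegE/= oppr0 maxxx.
  by rewrite funeposE/= maxxx.
rewrite (_ : (fun t => complex.Im _) = fun=> 0); last by apply/funext => t; rewrite h.
rewrite zz; congr (_ +i* _).
rewrite /rsum [X in (_ - X)%E]esum1 ?sube0; last first.
  by move=> t _; rewrite funenegE/= h/= max_r// lee_fin oppr_le0 sqr_ge0.
congr fine; apply: eq_esum => t _.
by rewrite funeposE/= h/= max_l// lee_fin sqr_ge0.
Qed.

Lemma l2e_subproof (t0 : T) :
  (fun t : T => (t == t0)%:R : R[i]) \in @sq_summable R T.
Proof.
rewrite -topredE/= /sq_summable /sqsum.
have -> : \esum_(t in [set: T]) (Normc.normc ((t == t0)%:R : R[i]) ^+ 2)%:E =
    \esum_(t in [set t0]) (1%:E : \bar R).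
  rewrite [RHS]esum_mkcond; apply: eq_esum => t _.
  have [->|tt0] := eqVneq t t0; first by rewrite mem_set// Normc.normc1 expr1n.
  by rewrite memNset ?Normc.normc0 ?expr0n//; exact/eqP.
by rewrite esum_set1// ltry.
Qed.

Definition l2e (t0 : T) : l2 R T := L2 (l2e_subproof t0).

End L2.

Section L2ext.
Context {R : realType} {T : choiceType}.

Lemma l2ext_subproof (A : set T) (f : l2 R A) :
  (fun t : T => oapp f 0 (insub t : option A)) \in @sq_summable R T.
Proof.
rewrite -topredE/= /sq_summable; have fs : (sqsum f < +oo)%E := valP f.
apply: (le_lt_trans _ fs).
rewrite le_eqVlt; apply/orP; left; apply/eqP.
have valA : set_bij [set: A] A val.
  split; [by move=> a _; exact/set_mem/(valP a)|by move=> a b _ _; exact: val_inj|].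
  by move=> t At; exists (SigSub (mem_set At)).
transitivity (\esum_(t in A)
    (Normc.normc (oapp f 0 (insub t : option A)) ^+ 2)%:E).
  rewrite /sqsum [RHS]esum_mkcond; apply: eq_esum => t _.
  by case: ifPn => // tA; rewrite insubN// [oapp _ _ _]/= Normc.normc0 expr0n.
rewrite (reindex_esum _ _ _ _ valA); apply: eq_esum => a _.
by rewrite valK.
Qed.

(* The embedding of l2(A) into l2(T) by extension by zero. *)
Definition l2ext (A : set T) (f : l2 R A) : l2 R T := L2 (l2ext_subproof f).

End L2ext.

Arguments l2ext {R T} A f.

Definition l2sub (R : realType) (T : choiceType) (A : set T) : set (l2 R T) :=
  range (l2ext A).

Section Representations.
Context {R : realType} {Omega : choiceType}.

(* [pi] is a unital *-homomorphism from [A] to the bounded operators on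
   l2(Omega); [rep_star] says that [pi (star a)] is the adjoint of [pi a], and
   continuity of the linear map [pi a] is boundedness. *)
Record is_representation (A : cstarType R) (pi : A -> l2 R Omega -> l2 R Omega) :
    Prop := {
  rep_op_linear : forall (a : A) (c : R[i]) (u v : l2 R Omega),
    pi a (c *: u + v) = c *: pi a u + pi a v;
  rep_op_bounded : forall a : A, continuous (pi a);
  rep_linear : forall (c : R[i]) (a b : A) (v : l2 R Omega),
    pi (c *: a + b) v = c *: pi a v + pi b v;
  rep_mul : forall (a b : A) (v : l2 R Omega), pi (a * b) v = pi a (pi b v);
  rep_one : forall v : l2 R Omega, pi 1 v = v;
  rep_star : forall (a : A) (u v : l2 R Omega),
    l2inner (pi a u) v = l2inner u (pi (star a) v)
}.

(* When [s] generates [A], at most one [pi] satisfies this, since the linear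
   span of the [l2e w] is dense. *)
Definition is_induced_representation (J : Type) (A : cstarType R) (s : J -> A)
    (f : J -> Omega -> Omega) (pi : A -> l2 R Omega -> l2 R Omega) : Prop :=
  is_representation pi /\
  forall (j : J) (w : Omega), pi (s j) (l2e w) = l2e (f j w).

Record is_closed_invariant_subspace (A : cstarType R)
    (pi : A -> l2 R Omega -> l2 R Omega) (V : set (l2 R Omega)) : Prop := {
  cis_zero : V 0;
  cis_linear : forall (c : R[i]) (u v : l2 R Omega), V u -> V v -> V (c *: u + v);
  cis_closed : closed V;
  cis_invariant : forall (a : A) (v : l2 R Omega), V v -> V (pi a v)
}.

End Representations.

Section BFS.
Context {Omega : choiceType}.

Record is_bfs (J : Type) (f : J -> Omega -> Omega) : Prop := {
  bfs_inj : forall j, injective (f j);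
  bfs_disj : forall i j, i <> j -> range (f i) `&` range (f j) = set0;
  bfs_cover : \bigcup_j range (f j) = [set: Omega]
}.

(* The map equal to the inverse of [f j] on the range of [f j]. *)
Definition bfs_map (J : Type) (f : J -> Omega -> Omega) (w : Omega) : Omega :=
  xget w [set x | exists j, f j x = w].

Lemma bfs_mapK (J : Type) (f : J -> Omega -> Omega) : is_bfs f ->
  forall j x, bfs_map f (f j x) = x.
Proof.
move=> bf j x; rewrite /bfs_map; case: xgetP => [y _ [i iy]|H]; last by have := H x; case; exists j.
have [ij|/(bfs_disj bf) ij] := pselect (i = j).
  by move: iy; rewrite ij => /(bfs_inj bf).
have : (range (f i) `&` range (f j)) (f j x) by split; [exists y|exists x].
by rewrite ij.
Qed.

Section Jump.
Variables (F : Omega -> Omega) (E : set Omega).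

Definition recurrent : set Omega :=
  [set x | infinite_set [set n : nat | E (iter n F x)]].

Definition is_entry_time (x : Omega) (n : nat) : Prop :=
  E (iter n F x) /\ forall m : nat, E (iter m F x) -> (n <= m)%N.

(* x |-> F^(r(x) + 1)(x); only its values on [recurrent] matter. *)
Definition jump (x : Omega) : Omega := iter (xget 0%N (is_entry_time x)).+1 F x.

End Jump.

(* f_{i_1} \o ... \o f_{i_k} for w = [:: i_1; ...; i_k]. *)
Definition word_map (J : Type) (f : J -> Omega -> Omega) (w : seq J) :
    Omega -> Omega :=
  foldr (fun i g => f i \o g) id w.

(* The inverse branches of [jump (bfs_map f) E] on [recurrent (bfs_map f) E]; see
   [inverse_branchesK]. *)
Definition inverse_branches (J : eqType) (f : J -> Omega -> Omega) (E : set Omega) :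
    set (recurrent (bfs_map f) E -> recurrent (bfs_map f) E) :=
  [set g | exists (w : seq J) (i : J),
     [/\ range (f i) `<=` E,
         forall i', i' \in w -> range (f i') `&` E = set0
       & forall x, val (g x) = word_map f (rcons w i) (val x)]].

Arguments inverse_branches {J} f E.

Lemma inverse_branchesK (J : eqType) (f : J -> Omega -> Omega) (E : set Omega) g :
  is_bfs f -> inverse_branches f E g ->
  forall x, jump (bfs_map f) E (val (g x)) = val x.
Proof.
move=> bf [w [i [iE wE gE]]] x; rewrite {}gE /jump.
move: (val x) => {g}y {x}.
have it0 v z : iter (size v) (bfs_map f) (word_map f v z) = z.
  by elim: v z => //= j v IH z; rewrite -iterS iterSr/= (bfs_mapK bf) IH.
have itE m : (m < size w)%N ->
    ~ E (iter m (bfs_map f) (word_map f (rcons w i) y)).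
  elim: w wE m => //= j w IH wE [_|m mw].
    move=> Ej; have : (range (f j) `&` E) (f j (word_map f (rcons w i) y)).
      by split=> //; exists (word_map f (rcons w i) y).
    by rewrite wE// mem_head.
  rewrite iterSr (bfs_mapK bf); apply: IH => // j' j'w.
  by apply: wE; rewrite in_cons j'w orbT.
have itw : iter (size w) (bfs_map f) (word_map f (rcons w i) y) = f i y.
  have -> : word_map f (rcons w i) y = word_map f w (f i y).
    by elim: (w) => //= j v ->.
  exact: it0.
have ew : is_entry_time (bfs_map f) E (word_map f (rcons w i) y) (size w).
  split; first by rewrite itw; apply: iE; exists y.
  by move=> m Em; rewrite leqNgt; apply/negP => /itE.
case: xgetP => [n _ [En nm]|H]; last by have := H (size w).
have -> : n = size w.
  apply/eqP; rewrite eqn_leq nm/=; last by case: ew.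
  by case: ew => _; apply.
by rewrite iterS itw (bfs_mapK bf).
Qed.

End BFS.

Arguments inverse_branches {Omega J} f E.

Section SCFA.
Context {R : realType}.

Definition unit_itv : set R := [set x | 0 <= x <= 1].

Definition Irr : set R := unit_itv `&` irrational.

Definition moebius_den (M : 'M[int]_2) (x : R) : R := (M 1 0)%:~R * x + (M 1 1)%:~R.

Definition moebius (M : 'M[int]_2) (x : R) : R :=
  ((M 0 0)%:~R * x + (M 0 1)%:~R) / moebius_den M x.

(* On the unit interval [h] is the action of an element of PGL_2(Z), represented
   by a matrix M (M and -M act in the same way).  Division by zero being 0, the
   absence of poles has to be required explicitly. *)
Definition is_fractional_linear (h : R -> R) : Prop :=
  exists M : 'M[int]_2, (\det M = 1 \/ \det M = -1) /\
    forall x, unit_itv x -> moebius_den M x != 0 /\ h x = moebius M x.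

Definition is_unimodular_interval (U : set R) : Prop :=
  exists p q p' q' : nat,
    [/\ (0 < q)%N && (0 < q')%N, coprime p q && coprime p' q',
        p%:Z * q'%:Z - p'%:Z * q%:Z = -1,
        U = [set x | p%:R / q%:R <= x <= p'%:R / q'%:R] & U `<=` unit_itv].

Record is_unimodular_partition (N : nat) (U : 'I_N -> set R) : Prop := {
  up_unimodular : forall i, is_unimodular_interval (U i);
  up_cover : \bigcup_i U i = unit_itv;
  up_meet : forall i j, i != j -> forall x y,
    (U i `&` U j) x -> (U i `&` U j) y -> x = y
}.

(* Only the values of [scfa_h i] on the unit interval matter; that it maps this
   interval to itself is part of [scfa_partition]. *)
Record scfa (N : nat) : Type := Scfa {
  scfa_h : 'I_N -> R -> R;
  scfa_gt1 : (1 < N)%N;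
  scfa_flt : forall i, is_fractional_linear (scfa_h i);
  scfa_partition : is_unimodular_partition (fun i => scfa_h i @` unit_itv);
  scfa_left_to_right : forall i j : 'I_N, (i < j)%N ->
    forall x y, unit_itv x -> unit_itv y -> scfa_h i x <= scfa_h j y
}.

Section SCFABfs.
Context {N : nat}.
Variable h : scfa N.

Lemma rational_moebius (M : 'M[int]_2) x : rational x -> rational (moebius M x).
Proof.
move=> [q _ <-]; exists (((M 0 0)%:~R * q + (M 0 1)%:~R) /
  ((M 1 0)%:~R * q + (M 1 1)%:~R)) => //.
by rewrite fmorph_div/= !rmorphD !rmorphM/= !ratr_int.
Qed.

Lemma det2 (M : 'M[int]_2) : \det M = M 0 0 * M 1 1 - M 0 1 * M 1 0.
Proof.
have l0 : lift 0 0 = 1 :> 'I_2 by apply/val_inj.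
have l1 : lift 1 0 = 0 :> 'I_2 by apply/val_inj.
rewrite (expand_det_row _ 0) !big_ord_recl big_ord0 addr0 /cofactor !det_mx11 !mxE /=.
by rewrite !(ord1 ord0) l0 l1 expr0 expr1 mul1r mulN1r mulrN.
Qed.

Lemma det_neq0 (M : 'M[int]_2) : \det M = 1 \/ \det M = -1 ->
  (M 0 0)%:~R * (M 1 1)%:~R - (M 0 1)%:~R * (M 1 0)%:~R != 0 :> R.
Proof.
rewrite det2 -!intrM -intrB intr_eq0.
by move=> [] ->.
Qed.

Lemma moebius_inj (M : 'M[int]_2) x y : \det M = 1 \/ \det M = -1 ->
  moebius_den M x != 0 -> moebius_den M y != 0 ->
  moebius M x = moebius M y :> R -> x = y.
Proof.
move=> /det_neq0 d0 xd yd /eqP; rewrite /moebius eqr_div// => /eqP e.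
apply/eqP; rewrite -subr_eq0; apply/eqP/(mulfI d0); rewrite mulr0.
by move: e; rewrite /moebius_den => /eqP; rewrite -subr_eq0 => /eqP <-; ring.
Qed.

Lemma irrational_moebius (M : 'M[int]_2) x : \det M = 1 \/ \det M = -1 ->
  moebius_den M x != 0 -> irrational x -> irrational (moebius M x : R).
Proof.
move=> Mdet xd xi [r _ rE]; apply: xi.
have e : ratr r * moebius_den M x = (M 0 0)%:~R * x + (M 0 1)%:~R.
  by rewrite rE /moebius divfK.
have [z|nz] := eqVneq ((M 1 0)%:~R * r - (M 0 0)%:~R) 0.
  have z' : (M 1 0)%:~R * ratr r - (M 0 0)%:~R = 0 :> R.
    by have /(congr1 (@ratr R)) := z; rewrite rmorphB rmorphM/= !ratr_int rmorph0.
  have := det_neq0 Mdet; rewrite (_ : _ - _ = 0) ?eqxx//.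
  have a0 : (M 0 0)%:~R = (M 1 0)%:~R * ratr r :> R by apply/eqP; rewrite eq_sym -subr_eq0 z'.
  have b0 : (M 0 1)%:~R = (M 1 1)%:~R * ratr r :> R.
    apply/(addrI ((M 0 0)%:~R * x)); rewrite -e /moebius_den a0; ring.
  by rewrite a0 b0; ring.
exists (((M 0 1)%:~R - (M 1 1)%:~R * r) / ((M 1 0)%:~R * r - (M 0 0)%:~R)) => //.
rewrite fmorph_div/= !rmorphB !rmorphM/= !ratr_int.
have nz' : (M 1 0)%:~R * ratr r - (M 0 0)%:~R != 0 :> R.
  by have := nz; rewrite -(fmorph_eq0 (@ratr R)) rmorphB rmorphM/= !ratr_int.
apply: (mulIf nz'); rewrite divfK//; apply/eqP; rewrite -subr_eq0; apply/eqP.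
move: e; rewrite /moebius_den => /eqP; rewrite -subr_eq0 => /eqP e.
by rewrite -[RHS]oppr0 -e; ring.
Qed.

Lemma scfa_unit i x : unit_itv x -> unit_itv (scfa_h h i x).
Proof.
move=> x01; have [_ <- _] := scfa_partition h.
by exists i => //; exists x.
Qed.

Lemma scfa_irr i x : Irr x -> Irr (scfa_h h i x).
Proof.
move=> [x01 xi]; split; first exact: scfa_unit.
have [M [Md /(_ x x01)[xd ->]]] := scfa_flt h i.
exact: irrational_moebius.
Qed.

(* The restriction of [scfa_h h i] to the irrational points. *)
Definition scfa_map (i : 'I_N) (x : Irr) : Irr :=
  exist _ (scfa_h h i (val x)) (mem_set (scfa_irr i (set_mem (valP x)))).

Lemma scfa_mapE i x : val (scfa_map i x) = scfa_h h i (val x).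
Proof. by []. Qed.

Lemma scfa_inj i x y : unit_itv x -> unit_itv y ->
  scfa_h h i x = scfa_h h i y -> x = y.
Proof.
move=> x01 y01; have [M [Md H]] := scfa_flt h i.
have [xd ->] := H _ x01; have [yd ->] := H _ y01.
exact: moebius_inj.
Qed.

Lemma unimodular_irr (U : set R) x : is_unimodular_interval U ->
  U x -> irrational x -> exists a b : R, [/\ a < x, x < b &
    forall y, a <= y <= b -> U y].
Proof.
move=> [p [q [p' [q' [_ _ _ -> _]]]]] /= /andP[ax xb] xi.
exists (p%:R / q%:R), (p'%:R / q'%:R); split => //.
- rewrite lt_neqAle ax andbT; apply/eqP => e; apply: xi.
  by apply/rationalP; exists p%:Z, q; rewrite -e.
- rewrite lt_neqAle xb andbT; apply/eqP => e; apply: xi.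
  by apply/rationalP; exists p'%:Z, q'; rewrite e.
Qed.

Lemma scfa_bfs : is_bfs scfa_map.
Proof.
have [uni cov meet] := scfa_partition h.
have irrP (x : Irr) : Irr (val x) by exact: set_mem (valP x).
split.
- move=> i x y /(congr1 val)/= /scfa_inj xy; apply/val_inj.
  by apply: xy; [case: (irrP x)|case: (irrP y)].
- move=> i j ij; rewrite -subset0 => z [[x _ xz] [y _ yz]].
  have [zi zj] : (scfa_h h i @` unit_itv) (val z) /\ (scfa_h h j @` unit_itv) (val z).
    split; [exists (val x); [by case: (irrP x)|by rewrite -xz]|].
    by exists (val y); [case: (irrP y)|rewrite -yz].
  have [_ zirr] := irrP z.
  have [a [b [az zb Ui]]] := unimodular_irr (uni i) zi zirr.
  have [c [d [cz zd Uj]]] := unimodular_irr (uni j) zj zirr.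
  pose m := Num.min b d.
  have zm : val z < m by rewrite lt_min zb.
  have mm : ((scfa_h h i @` unit_itv) `&` (scfa_h h j @` unit_itv)) m.
    split; [apply: Ui|apply: Uj].
    + by rewrite (ltW (lt_trans az zm))/= ge_min lexx.
    + by rewrite (ltW (lt_trans cz zm))/= ge_min lexx orbT.
  have /eqP := ij; rewrite -[_ == _]negbK => /negPn/negbTE.
  by move=> /negbT /meet /(_ _ _ (conj zi zj) mm) e; rewrite -e ltxx in zm.
- rewrite -subTset => z _; have [z01 zirr] := irrP z.
  have : unit_itv (val z) by [].
  rewrite -cov => -[i _ [x x01 xz]].
  have xI : Irr x.
    split => // xr; apply: zirr; rewrite -xz.
    have [M [Md /(_ x x01)[xd ->]]] := scfa_flt h i.
    exact: rational_moebius.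
  by exists i => //; exists (exist _ x (mem_set xI)) => //; apply/val_inj.
Qed.

End SCFABfs.

End SCFA.

Arguments Irr : clear implicits.
Arguments scfa : clear implicits.

(* Main.v *)
Require Import Defs.
From HB Require Import structures.
From mathcomp Require Import all_boot all_order all_algebra.
From mathcomp Require Import complex ring lra.
From mathcomp Require Import all_classical all_reals all_analysis.

Set Implicit Arguments.
Unset Strict Implicit.
Unset Printing Implicit Defensive.

Import Order.TTheory GRing.Theory Num.Theory.
Import numFieldNormedType.Exports.

Local Open Scope classical_set_scope.
Local Open Scope ring_scope.

(* The branches g_j are coded by pairwise distinct words w_j whose last letter
   lies in E and whose other letters do not; such words form a prefix code, so
   the products S_{w_j} are isometries with orthogonal ranges and the universal
   property gives phi : T_j |-> S_{w_j}.

   Injectivity of phi is the simplicity of O_infinity.  Let a lie in a proper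
   ideal I.  For every b, the compressions T_j^* b T_j tend to a scalar (the
   vacuum state of b); if b is in I the scalar is 0, since otherwise I would
   contain an invertible element.  Hence X_j^* a Y_j -> 0 for families X, Y that
   are linear in T_j.  On the other hand one can choose such families U, V, W
   with U^* U + W^* V = 1 and U, V almost commuting with a, so that a is close to
   U^* a U + W^* a V.

   The representations are determined on coordinates by their values on the
   basis, and identities proved on generators extend to the whole algebra because
   ||pi(a) v|| <= ||a|| ||v||; the latter holds since 1 - a^* a = b^* b for some b
   when ||a|| < 1. *)

(** * C*-algebras *)

Section CStarBasics.
Context {R : realType} {A : cstarType R}.
Implicit Types (b h x y z : A) (c : R[i]) (r e : R).

Lemma star0 : star (0 : A) = 0.
Proof. by have := starZ 0 (0 : A); rewrite !scale0r => ->; rewrite rmorph0 scale0r. Qed.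

Lemma starN x : star (- x) = - star x.
Proof. by apply/eqP; rewrite -addr_eq0 -starD addNr star0. Qed.

Lemma starB x y : star (x - y) = star x - star y.
Proof. by rewrite starD starN. Qed.

Lemma star1 : star (1 : A) = 1.
Proof. by have := starM 1 (star (1 : A)); rewrite mul1r starK mul1r. Qed.

Lemma star_sum (I : Type) (r : seq I) (P : pred I) (F : I -> A) :
  star (\sum_(i <- r | P i) F i) = \sum_(i <- r | P i) star (F i).
Proof. by elim/big_rec2: _ => [|i y z _ <-]; rewrite ?star0 ?starD. Qed.

Lemma starZr r x : star (r%:C%C *: x) = r%:C%C *: star x.
Proof. by rewrite starZ; congr (_ *: _); apply/eqP; rewrite eq_complex /= oppr0 !eqxx. Qed.

Lemma cnormZr r x : 0 <= r -> cnorm (r%:C%C *: x) = r * cnorm x.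
Proof.
by move=> r0; rewrite cnormZ /= expr0n /= addr0 sqrtr_sqr ger0_norm.
Qed.

Lemma cnorm0 : cnorm (0 : A) = 0.
Proof. by rewrite -(scale0r (0 : A)) cnormZ Normc.normc0 mul0r. Qed.

Lemma cnormN x : cnorm (- x) = cnorm x.
Proof.
by rewrite -scaleN1r cnormZ -[X in Normc.normc X]/(- 1 : Rcomplex R) normcN
  Normc.normc1 mul1r.
Qed.

Lemma cnorm_ge0 x : 0 <= cnorm x.
Proof.
by have := cnormD_le x (- x); rewrite subrr cnorm0 cnormN -mulr2n pmulrn_lge0.
Qed.

Lemma cnormB x y : cnorm (x - y) = cnorm (y - x).
Proof. by rewrite -cnormN opprB. Qed.

Lemma cnormB_le x y : cnorm (x - y) <= cnorm x + cnorm y.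
Proof. by rewrite -[cnorm y]cnormN cnormD_le. Qed.

Lemma cnorm_triangle y x z : cnorm (x - z) <= cnorm (x - y) + cnorm (y - z).
Proof. by have := cnormD_le (x - y) (y - z); rewrite addrA subrK. Qed.

Lemma cnorm_sum_le (I : Type) (r : seq I) (P : pred I) (F : I -> A) :
  cnorm (\sum_(i <- r | P i) F i) <= \sum_(i <- r | P i) cnorm (F i).
Proof.
elim/big_rec2: _ => [|i y z _ h]; first by rewrite cnorm0.
by rewrite (le_trans (cnormD_le _ _))// lerD2l.
Qed.

(** The C*-identity gives [cnorm y ^+ 2 <= cnorm (star y) * cnorm y]. Cancelling [cnorm y] yields
    one inequality, and [starK] turns it into the other. *)
Lemma cnorm_star x : cnorm (star x) = cnorm x.
Proof.
suff H y : cnorm y <= cnorm (star y).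
  by apply/eqP; rewrite eq_le H andbT; have := H (star x); rewrite starK.
have [->|y0] := eqVneq (cnorm y) 0; first exact: cnorm_ge0.
have {}y0 : 0 < cnorm y by rewrite lt_def y0 cnorm_ge0.
by rewrite -(ler_pM2r y0) -expr2 -cstar_identity cnormM_le.
Qed.

Lemma cnorm_le1 x : cnorm x ^+ 2 <= 1 -> cnorm x <= 1.
Proof. by rewrite -[X in _ <= X](expr1n R 2) ler_sqr ?nnegrE ?cnorm_ge0. Qed.

(** By the C*-identity the norm of a projection equals its own square, so it is 0 or 1. *)
Lemma cnorm_proj_le1 x : star x = x -> x * x = x -> cnorm x <= 1.
Proof.
move=> sx xx; have := cstar_identity x; rewrite sx xx.
have [->//|x0] := eqVneq (cnorm x) 0; rewrite expr2 -{1}[cnorm x]mulr1.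
by move/(mulfI x0) => <-.
Qed.

(** Such an [x] is a partial isometry with initial projection [y]. *)
Lemma cnorm_pisom_le1 x y : star x * x = y -> y * y = y -> cnorm x <= 1.
Proof.
move=> xy yy; apply: cnorm_le1; rewrite -cstar_identity xy cnorm_proj_le1//.
by rewrite -xy starM starK.
Qed.

Lemma cnorm1_le1 : cnorm (1 : A) <= 1.
Proof. by apply: cnorm_proj_le1; rewrite ?mulr1 ?star1. Qed.

Lemma cnorm_eq0P x : (forall e, 0 < e -> cnorm x < e) -> x = 0.
Proof.
move=> H; apply: cnorm0_eq0; apply/eqP; rewrite eq_le cnorm_ge0 andbT leNgt.
by apply/negP => /H; rewrite ltxx.
Qed.

Lemma pow_lt_eps r e : 0 <= r < 1 -> 0 < e -> exists n0, forall n, (n0 <= n)%N -> r ^+ n < e.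
Proof.
move=> /andP[r0 r1] e0.
have := @cvg_expr R r; rewrite ger0_norm// => /(_ r1) /cvgrPdist_lt /(_ _ e0)[n0 _ H].
exists n0 => n /H; rewrite sub0r normrN ger0_norm ?exprn_ge0//.
Qed.

(** Banach's argument along the orbit of 0. The contraction is asked on this orbit only, because
    [y |-> (h + y^2) / 2], used below, contracts only on a ball around 0. *)
Lemma contraction_fixpoint (f : A -> A) r : 0 <= r < 1 ->
  (forall m n : nat, cnorm (f (iter m f 0) - f (iter n f 0)) <=
     r * cnorm (iter m f 0 - iter n f 0)) ->
  exists l : A, forall e, 0 < e -> exists n0, forall n, (n0 <= n)%N -> cnorm (iter n f 0 - l) < e.
Proof.
move=> /andP[r0 r1] H; have r1' : 0 < 1 - r by rewrite subr_gt0.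
set d := cnorm (f 0).
have step n : cnorm (iter n.+1 f 0 - iter n f 0) <= r ^+ n * d.
  elim: n => [|n IH]; first by rewrite expr0 mul1r /= subr0.
  by rewrite (le_trans (H n.+1 n))// exprS -mulrA ler_wpM2l.
have tail n k : cnorm (iter (n + k) f 0 - iter n f 0) <= r ^+ n * d / (1 - r).
  (* The factor [1 - r ^+ k], from the partial geometric sum, makes the induction on [k] close. *)
  suff : cnorm (iter (n + k) f 0 - iter n f 0) <= r ^+ n * d * (1 - r ^+ k) / (1 - r).
    move/le_trans; apply; rewrite ler_pM2r ?invr_gt0//.
    rewrite ler_piMr ?mulr_ge0 ?exprn_ge0 ?cnorm_ge0// lerBlDr lerDl exprn_ge0//.
  elim: k => [|k IH]; first by rewrite addn0 subrr cnorm0 expr0 subrr mulr0 mul0r.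
  apply: (le_trans (cnorm_triangle (iter (n + k) f 0) _ _)).
  rewrite addnS; apply: (le_trans (lerD (step _) IH)).
  rewrite le_eqVlt; apply/orP; left; apply/eqP; rewrite exprD exprS; field.
  by rewrite gt_eqF.
apply: cnorm_complete => e e0.
(* Adding 1 to [d] keeps the denominator positive when [d = 0]; the same device recurs below with
   other norms. *)
have [n0 Hn] : exists n0, forall n, (n0 <= n)%N -> r ^+ n < e * (1 - r) / (d + 1).
  apply: pow_lt_eps; first by rewrite r0.
  by rewrite divr_gt0 ?mulr_gt0// ltr_wpDl ?cnorm_ge0.
have d0 : 0 < d + 1 by rewrite ltr_wpDl ?cnorm_ge0.
have key n k : (n0 <= n)%N -> cnorm (iter (n + k) f 0 - iter n f 0) < e.
  move=> /Hn h; apply: (le_lt_trans (tail n k)).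
  rewrite ltr_pdivrMr//; move: h; rewrite ltr_pdivlMr// => h.
  by apply: (le_lt_trans _ h); rewrite ler_wpM2l ?exprn_ge0// lerDl.
exists n0 => m n mn nn; case: (leqP m n) => mn'.
  by rewrite cnormB -(subnKC mn') key.
by rewrite -(subnKC (ltnW mn')) key.
Qed.

(** The inverse is the sum of a Neumann series, obtained as the fixed point of
    [z |-> 1 - (y - 1) z]. A right inverse is enough to bring 1 into an ideal. *)
Lemma right_inverse_near1 y : cnorm (y - 1) < 1 -> exists z, y * z = 1.
Proof.
move=> y1; pose f z := 1 - (y - 1) * z.
have [|m n|l Hl] := @contraction_fixpoint f (cnorm (y - 1)); first by rewrite cnorm_ge0.
  rewrite /f opprB addrC addrA subrK -mulrBr.
  by rewrite (le_trans (cnormM_le _ _))// [cnorm (_ - iter m _ _)]cnormB.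
exists l; apply/eqP; rewrite -subr_eq0; apply/eqP/cnorm_eq0P => e e0.
have e2 : 0 < e / 2 by rewrite divr_gt0.
have [n0 H] := Hl _ e2.
have -> : y * l - 1 = (l - iter n0.+1 f 0) + (y - 1) * (l - iter n0 f 0).
  rewrite /= {1}/f opprB mulrBr; set q := (y - 1) * iter _ _ _.
  by rewrite (mulrBl l y 1) mul1r addrACA [l + _]addrC subrK [q - 1]addrC addrK.
have h1 := H n0.+1 (leqnSn _); have h2 := H n0 (leqnn _).
apply: (le_lt_trans (cnormD_le _ _)).
rewrite [ltRHS]splitr ltrD// 1?cnormB//.
apply: (le_lt_trans (cnormM_le _ _)); apply: (le_lt_trans _ h2); rewrite [leRHS]cnormB.
by rewrite ler_piMl ?cnorm_ge0// ltW.
Qed.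

(* The fixed point of [y |-> (h + y^2) / 2] satisfies [(1 - y)^2 = 1 - h]. *)
Lemma one_sub_star_mul_square h : star h = h -> cnorm h < 1 ->
  exists b, 1 - h = star b * b.
Proof.
move=> sh h1; pose f y := ((2^-1 : R)%:C)%C *: (h + y * y).
set r := cnorm h; have r0 : 0 <= r := cnorm_ge0 h.
have half0 : 0 <= (2^-1 : R) by rewrite invr_ge0.
(* The iterates stay in the ball of radius [r < 1], on which [f] is Lipschitz with constant [r]. *)
have fr n : cnorm (iter n f 0) <= r.
  elim: n => [|n IH]; first by rewrite cnorm0.
  rewrite /= {1}/f cnormZr// (le_trans (ler_wpM2l half0 (cnormD_le _ _)))// -/r.
  have : cnorm (iter n f 0 * iter n f 0) <= r.
    rewrite (le_trans (cnormM_le _ _))// (le_trans (ler_pM _ _ IH IH)) ?cnorm_ge0//.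
    by rewrite ler_piMr// ltW.
  by lra.
have fs n : star (iter n f 0) = iter n f 0.
  elim: n => [|n IH]; first by rewrite star0.
  by rewrite /= {1 3}/f starZr starD starM IH sh.
have [|m n|l Hl] := @contraction_fixpoint f r; first by rewrite r0.
  set a := iter m f 0; set b := iter n f 0.
  rewrite /f -scalerBr cnormZr// opprD addrACA subrr add0r.
  have -> : a * a - b * b = a * (a - b) + (a - b) * b.
    by rewrite mulrBr mulrBl addrA subrK.
  have := cnormD_le (a * (a - b)) ((a - b) * b).
  have := cnormM_le a (a - b); have := cnormM_le (a - b) b.
  have := ler_wpM2r (cnorm_ge0 (a - b)) (fr m).
  have := ler_wpM2l (cnorm_ge0 (a - b)) (fr n).
  rewrite -/a -/b; lra.
have lr : cnorm l <= r.
  apply/ler_addgt0Pr => e e0; have [n0 /(_ _ (leqnn _))] := Hl _ e0.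
  have := cnormD_le (iter n0 f 0) (l - iter n0 f 0); rewrite addrC subrK cnormB.
  by have := fr n0; lra.
have ls : star l = l.
  apply/eqP; rewrite -subr_eq0; apply/eqP/cnorm_eq0P => e e0.
  have e2 : 0 < e / 2 by rewrite divr_gt0.
  have [n0 /(_ _ (leqnn _)) H] := Hl _ e2.
  apply: (le_lt_trans (cnorm_triangle (iter n0 f 0) _ _)).
  rewrite -{1}(fs n0) -starB cnorm_star cnormB; lra.
have lf : f l = l.
  apply/eqP; rewrite -subr_eq0; apply/eqP/cnorm_eq0P => e e0.
  have e2 : 0 < e / 2 by rewrite divr_gt0.
  have [n0 H] := Hl _ e2.
  apply: (le_lt_trans (cnorm_triangle (iter n0.+1 f 0) _ _)).
  have := H n0.+1 (leqnSn _); have := H n0 (leqnn _).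
  suff : cnorm (f l - iter n0.+1 f 0) <= cnorm (iter n0 f 0 - l) by lra.
  rewrite /= /f -/f; set a := iter n0 f 0.
  rewrite -scalerBr cnormZr// opprD addrACA subrr add0r.
  have -> : l * l - a * a = l * (l - a) + (l - a) * a.
    by rewrite mulrBr mulrBl addrA subrK.
  rewrite -(cnormB l a).
  have := cnormD_le (l * (l - a)) ((l - a) * a).
  have := cnormM_le l (l - a); have := cnormM_le (l - a) a.
  have := ler_wpM2r (cnorm_ge0 (l - a)) lr.
  have := ler_wpM2l (cnorm_ge0 (l - a)) (fr n0).
  have := ler_wpM2r (cnorm_ge0 (l - a)) (ltW h1).
  rewrite -/a -/r; lra.
exists (1 - l); rewrite starB star1 ls mulrBr mulr1 mulrBl mul1r.
have -> : h = l + l - l * l.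
  have : ((2 : R)%:C)%C *: f l = l + l.
    rewrite lf -[in RHS](scale1r l) -scalerDl; congr (_ *: _).
    by apply/eqP; rewrite eq_complex /= addr0 !eqxx.
  rewrite /f scalerA -rmorphM/= mulfV// scale1r => <-; exact/esym/addrK.
by rewrite !opprD !opprK !addrA.
Qed.

(** [C] need not be stable under [star]: generation is applied to the set of [x] such that [C] holds
    for both [x] and [star x]. This is why the generators and their adjoints are separate
    premises. *)
Lemma generated_ind (J : Type) (s : J -> A) (C : A -> Prop) : generated_by s ->
  C 1 -> (forall c x y, C x -> C y -> C (c *: x + y)) ->
  (forall x y, C x -> C y -> C (x * y)) ->
  (forall x, (forall e, 0 < e -> exists2 y, C y & cnorm (x - y) < e) -> C x) ->
  (forall j, C (s j)) -> (forall j, C (star (s j))) -> forall x, C x.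
Proof.
move=> gen C1 Clin Cmul Ccl Cs Css.
suff DT : [set x | C x /\ C (star x)] = setT.
  by move=> x; have [] : [set x | C x /\ C (star x)] x by rewrite DT.
apply: gen => [|j]; last by split; [exact: Cs|exact: Css].
split.
- by rewrite /= star1.
- move=> c x y [Cx Csx] [Cy Csy]; split; first exact: Clin.
  by rewrite starD starZ; exact: Clin.
- move=> x y [Cx Csx] [Cy Csy]; split; first exact: Cmul.
  by rewrite starM; exact: Cmul.
- by move=> x [Cx Csx]; split; rewrite ?starK.
- move=> x H; split; apply: Ccl => e e0; have [y [Cy Csy] xy] := H e e0.
    by exists y.
  by exists (star y); rewrite // -starB cnorm_star.
Qed.

End CStarBasics.

(** * Simplicity of O_infinity *)

Section CuntzInfinity.
Context {R : realType} {A : cstarType R} (T : nat -> A).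
Hypothesis orthT : forall i j, star (T i) * T j = (i == j)%:R.
Implicit Types (b x y z X Y Z : A) (e : R).

Lemma cnorm_isom i : cnorm (T i) <= 1.
Proof. by apply: (cnorm_pisom_le1 (orthT i i)); rewrite eqxx mulr1. Qed.

(* [T i * X = endo n X * T i] for [i < n], so commuting approximately with
   [T i] amounts to being approximately fixed by [endo n]. *)
Definition endo n X : A := \sum_(i < n) T i * X * star (T i).

Lemma endo0 n : endo n 0 = 0.
Proof. by rewrite /endo big1// => i _; rewrite mulr0 mul0r. Qed.

Lemma endoD n X Y : endo n (X + Y) = endo n X + endo n Y.
Proof. by rewrite /endo -big_split; apply: eq_bigr => i _; rewrite mulrDr mulrDl. Qed.

Lemma endoB n X Y : endo n (X - Y) = endo n X - endo n Y.
Proof. by rewrite /endo -sumrB; apply: eq_bigr => i _; rewrite mulrBr mulrBl. Qed.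

Lemma endoZ n c X : endo n (c *: X) = c *: endo n X.
Proof. by rewrite /endo scaler_sumr; apply: eq_bigr => i _; rewrite -scalerAr -scalerAl. Qed.

Lemma endo_sum n (I : Type) (r : seq I) (P : pred I) (F : I -> A) :
  endo n (\sum_(i <- r | P i) F i) = \sum_(i <- r | P i) endo n (F i).
Proof. by elim/big_rec2: _ => [|i y z _ <-]; rewrite ?endo0 ?endoD. Qed.

Lemma star_endo n X : star (endo n X) = endo n (star X).
Proof. by rewrite star_sum; apply: eq_bigr => i _; rewrite !starM starK mulrA. Qed.

Lemma endo_mulT n X i : (i < n)%N -> endo n X * T i = T i * X.
Proof.
move=> ltin; rewrite /endo mulr_suml (bigD1 (Ordinal ltin))//= big1 ?addr0.
  by rewrite -!mulrA orthT eqxx mulr1.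
move=> k ki; rewrite -mulrA orthT (_ : _ == _ = false) ?mulr0//.
by apply/negbTE.
Qed.

Lemma starT_mul_endo n X i : (i < n)%N -> star (T i) * endo n X = X * star (T i).
Proof.
move=> ltin; rewrite -[LHS]starK starM starK star_endo endo_mulT//.
by rewrite starM starK.
Qed.

(** The [T i] are isometries with orthogonal ranges, so only the diagonal terms of the product
    survive; [endo n] is thus a *-endomorphism, with [endo n 1] a projection. *)
Lemma endoM n X Y : endo n X * endo n Y = endo n (X * Y).
Proof.
rewrite {2}/endo mulr_sumr; apply: eq_bigr => i _.
by rewrite !mulrA endo_mulT.
Qed.

Lemma iter_endoM n k X Y : iter k (endo n) X * iter k (endo n) Y = iter k (endo n) (X * Y).
Proof. by elim: k => //= k <-; rewrite endoM. Qed.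

Lemma star_iter_endo n k X : star (iter k (endo n) X) = iter k (endo n) (star X).
Proof. by elim: k => //= k <-; rewrite star_endo. Qed.

Lemma iter_endo0 n k : iter k (endo n) 0 = 0.
Proof. by elim: k => //= k ->; rewrite endo0. Qed.

Lemma iter_endoB n k X Y :
  iter k (endo n) (X - Y) = iter k (endo n) X - iter k (endo n) Y.
Proof. by elim: k => //= k ->; rewrite endoB. Qed.

Lemma starT_endo n X j : (n <= j)%N -> star (T j) * endo n X = 0.
Proof.
move=> nj; rewrite mulr_sumr big1// => i _; rewrite !mulrA orthT.
by rewrite (_ : _ == _ = false) ?mul0r// gtn_eqF// (leq_trans (ltn_ord i)).
Qed.

(** In the Fock picture the range consists of words with [k] letters below [n] followed by the
    letter [j >= n]; the position of this first large letter separates different [k]. *)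
Lemma iter_endo_orth n j (k l : nat) X Y : (n <= j)%N ->
  star (iter k (endo n) (T j * X)) * iter l (endo n) (T j * Y) =
  if k == l then iter k (endo n) (star X * Y) else 0.
Proof.
move=> nj.
(* For unequal exponents the common [iter r (endo n)] factors out, and [star (T j) * endo n _ = 0]
   remains inside. *)
have H (r s : nat) (X' Y' : A) :
    star (iter r (endo n) (T j * X')) * iter (r + s.+1) (endo n) (T j * Y') = 0.
  rewrite iterD star_iter_endo iter_endoM starM -mulrA starT_endo// mulr0.
  exact: iter_endo0.
have [<-|] := eqVneq k l.
  rewrite star_iter_endo iter_endoM starM mulrA -(mulrA _ _ (T j)) orthT eqxx.
  by rewrite mulr1.
rewrite neq_ltn => /orP[kl|lk].
  by rewrite -(subnKC kl) addSnnS H.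
by rewrite -[LHS]starK starM starK -(subnKC lk) addSnnS H star0.
Qed.

(** The cross terms of [star X * X] vanish for the sum [X]. A sum of [m] orthogonal contractions
    thus grows only like the square root of [m], which averaging beats. *)
Lemma cnorm_orth_sum_sqr (m : nat) (X : nat -> A) :
  (forall k l, k != l -> star (X k) * X l = 0) -> (forall k, cnorm (X k) <= 1) ->
  cnorm (\sum_(k < m) X k) ^+ 2 <= m%:R.
Proof.
move=> oX nX; rewrite -cstar_identity star_sum.
have -> : (\sum_(k < m) star (X k)) * (\sum_(k < m) X k) =
    \sum_(k < m) star (X k) * X k.
  rewrite mulr_suml; apply: eq_bigr => k _.
  rewrite mulr_sumr (bigD1 k)//= big1 ?addr0// => l lk.
  by rewrite oX// eq_sym.
apply: (le_trans (cnorm_sum_le _ _ _)).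
rewrite -[m in leRHS]card_ord -sumr_const; apply: ler_sum => k _.
by rewrite cstar_identity expr_le1 ?cnorm_ge0.
Qed.

End CuntzInfinity.

(** * Asymptotically central families built from the isometries *)

Section CuntzInfinityCentral.
Context {R : realType} {A : cstarType R} (T : nat -> A).
Hypothesis orthT : forall i j, star (T i) * T j = (i == j)%:R.
Implicit Types (b x y z X Y : A) (e : R).

Lemma inv_nat_scaleMn n x : (0 < n)%N -> ((n%:R : R)^-1)%:C%C *: (x *+ n) = x.
Proof.
move=> n0; rewrite -[x *+ n]scaler_nat scalerA -(rmorph_nat (@real_complex R)).
by rewrite -rmorphM/= mulVf ?pnatr_eq0 -?lt0n// scale1r.
Qed.

(* In the Fock picture [defect n] projects onto the vacuum and
   [iter k (endo T n) 1] onto the words of length at least [k] in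
   [T 0, ..., T n.-1].  The contraction [avg_shift n j] takes care of the long
   words and [fock n j n], [avg_fock n j] of the short ones. *)
Definition defect n : A := 1 - endo T n 1.

Definition avg_shift n j : A :=
  ((Num.sqrt (n%:R : R))^-1)%:C%C *: \sum_(k < n) iter k (endo T n) (T j).

Definition fock n j m : A := \sum_(k < m) iter k (endo T n) (T j * defect n).

Definition avg_fock n j : A := ((n%:R : R)^-1)%:C%C *: \sum_(m < n) fock n j m.

Lemma star_defect n : star (defect n) = defect n.
Proof. by rewrite starB star_endo star1. Qed.

Lemma defect_idem n : defect n * defect n = defect n.
Proof.
by rewrite /defect mulrBr mulr1 mulrBl mul1r endoM// mulr1 subrr subr0.
Qed.

Lemma defect_mulT n i : (i < n)%N -> defect n * T i = 0.
Proof. by move=> ltin; rewrite mulrBl mul1r endo_mulT// mulr1 subrr. Qed.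

Lemma sum_iter_defect n m :
  \sum_(k < m) iter k (endo T n) (defect n) = 1 - iter m (endo T n) 1.
Proof.
elim: m => [|m IH]; first by rewrite big_ord0 subrr.
by rewrite big_ord_recr/= IH iter_endoB -iterSr addrA subrK.
Qed.

(** Different levels [k] are orthogonal, so only those below the smaller bound [m'] contribute, and
    they telescope. For [m = m'] this makes [fock n j m] a partial isometry whose initial space is
    spanned by the words shorter than [m], in the Fock picture. *)
Lemma fock_mul n j (m m' : nat) : (n <= j)%N -> (m' <= m)%N ->
  star (fock n j m) * fock n j m' = 1 - iter m' (endo T n) 1.
Proof.
move=> nj m'm; rewrite -sum_iter_defect star_sum mulr_sumr; apply: eq_bigr => k _.
have km : (k < m)%N := leq_trans (ltn_ord k) m'm.
rewrite mulr_suml (bigD1 (Ordinal km))//= big1 ?addr0.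
  by rewrite iter_endo_orth// eqxx star_defect defect_idem.
move=> l lk; rewrite iter_endo_orth//; case: eqP => // e.
by case/eqP: lk; exact/val_inj.
Qed.

Lemma cnorm_fock n j m : (n <= j)%N -> cnorm (fock n j m) <= 1.
Proof.
move=> nj; apply: (cnorm_pisom_le1 (fock_mul nj (leqnn m))).
by rewrite mulrBr mulr1 mulrBl mul1r iter_endoM// mulr1 subrr subr0.
Qed.

Lemma cnorm_avg_fock n j : (0 < n)%N -> (n <= j)%N -> cnorm (avg_fock n j) <= 1.
Proof.
move=> n0 nj; rewrite cnormZr ?invr_ge0// ler_pdivrMl ?ltr0n// mulr1.
apply: (le_trans (cnorm_sum_le _ _ _)).
rewrite -[n in leRHS]card_ord -sumr_const; apply: ler_sum => k _.
exact: cnorm_fock.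
Qed.

Lemma avg_shift_mul n j : (0 < n)%N -> (n <= j)%N ->
  star (avg_shift n j) * avg_shift n j =
  ((n%:R : R)^-1)%:C%C *: \sum_(k < n) iter k (endo T n) 1.
Proof.
move=> n0 nj; rewrite starZr -scalerAl -scalerAr scalerA -rmorphM/= -invfM.
rewrite -expr2 sqr_sqrtr//; congr (_ *: _).
rewrite star_sum mulr_suml; apply: eq_bigr => k _.
rewrite mulr_sumr (bigD1 k)//= big1 ?addr0; rewrite -[T j]mulr1.
  by rewrite iter_endo_orth// eqxx star1 mulr1.
move=> l lk; rewrite iter_endo_orth//; case: eqP => // e.
by case/eqP: lk; exact/val_inj.
Qed.

Lemma cnorm_iter_endo_isom n j k : (n <= j)%N -> cnorm (iter k (endo T n) (T j)) <= 1.
Proof.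
move=> nj; rewrite -[T j]mulr1; apply: (@cnorm_pisom_le1 _ _ _ (iter k (endo T n) 1)).
  by rewrite iter_endo_orth// eqxx star1 mulr1.
by rewrite iter_endoM// mulr1.
Qed.

Lemma cnorm_avg_shift n j : (0 < n)%N -> (n <= j)%N -> cnorm (avg_shift n j) <= 1.
Proof.
move=> n0 nj; apply: cnorm_le1; rewrite cnormZr ?invr_ge0 ?sqrtr_ge0//.
rewrite exprMn exprVn sqr_sqrtr// ler_pdivrMl ?ltr0n// mulr1.
apply: cnorm_orth_sum_sqr => [k l kl|k]; last exact: cnorm_iter_endo_isom.
by rewrite -[T j]mulr1 iter_endo_orth// (negbTE kl).
Qed.

(** With [Q_k = iter k (endo T n) 1], the first product is the mean of the [Q_k] over [k < n] and
    the second is the mean of the [1 - Q_k]. *)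
Lemma avg_partition n j : (0 < n)%N -> (n <= j)%N ->
  star (avg_shift n j) * avg_shift n j + star (fock n j n) * avg_fock n j = 1.
Proof.
move=> n0 nj; rewrite avg_shift_mul// -scalerAr -scalerDr mulr_sumr -big_split/=.
under eq_bigr => k _ do rewrite fock_mul// 1?ltnW// addrC subrK.
by rewrite sumr_const card_ord inv_nat_scaleMn.
Qed.

(** Applying [endo T n] raises the summation index by one, so the difference telescopes to two
    contractions, divided by the square root of [n]. *)
Lemma avg_shift_comm n j : (0 < n)%N -> (n <= j)%N ->
  cnorm (avg_shift n j - endo T n (avg_shift n j)) <= 2 / Num.sqrt n%:R.
Proof.
move=> n0 nj; rewrite endoZ -scalerBr endo_sum.
have -> m : \sum_(k < m) iter k (endo T n) (T j) -
    \sum_(k < m) endo T n (iter k (endo T n) (T j)) = T j - iter m (endo T n) (T j).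
  elim: m => [|m IH]; first by rewrite !big_ord0 !subrr.
  by rewrite !big_ord_recr/= opprD addrACA IH addrA subrK.
rewrite cnormZr ?invr_ge0 ?sqrtr_ge0// mulrC ler_wpM2r ?invr_ge0 ?sqrtr_ge0//.
rewrite (le_trans (cnormB_le _ _))// -[2]/(1 + 1)%R lerD//; first exact: cnorm_isom.
exact: cnorm_iter_endo_isom.
Qed.

Lemma fock_sub_shift n j m : fock n j m - endo T n (fock n j m) =
  T j * defect n - iter m (endo T n) (T j * defect n).
Proof.
rewrite /fock endo_sum; elim: m => [|m IH]; first by rewrite !big_ord0 !subrr.
by rewrite !big_ord_recr/= opprD addrACA IH addrA subrK.
Qed.

(** The term [T j * defect n] need not be small, but it drops out of the commutators with [T i] and
    [star (T i)] for [i < n <= j], as [defect n * T i = 0] and [star (T i) * T j = 0]. *)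
Lemma avg_fock_sub_shift n j : (0 < n)%N ->
  avg_fock n j - endo T n (avg_fock n j) = T j * defect n -
    ((n%:R : R)^-1)%:C%C *: \sum_(m < n) iter m (endo T n) (T j * defect n).
Proof.
move=> n0; rewrite endoZ -scalerBr endo_sum -sumrB.
under eq_bigr => m _ do rewrite fock_sub_shift.
by rewrite sumrB scalerBr sumr_const card_ord inv_nat_scaleMn.
Qed.

(** The sum of [n] orthogonal partial isometries has norm at most the square root of [n]. The factor
    2 only matches the bound for [avg_shift]. *)
Lemma cnorm_avg_fock_error n j : (0 < n)%N -> (n <= j)%N ->
  cnorm (((n%:R : R)^-1)%:C%C *: \sum_(m < n) iter m (endo T n) (T j * defect n))
    <= 2 / Num.sqrt n%:R.
Proof.
move=> n0 nj; rewrite cnormZr ?invr_ge0//.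
set c := cnorm _.
have c2 : c ^+ 2 <= n%:R.
  apply: cnorm_orth_sum_sqr => [k l kl|k]; first by rewrite iter_endo_orth// (negbTE kl).
  apply: (@cnorm_pisom_le1 _ _ _ (iter k (endo T n) (defect n))).
    by rewrite iter_endo_orth// eqxx star_defect defect_idem.
  by rewrite iter_endoM// defect_idem.
have s0 : 0 < Num.sqrt (n%:R : R) by rewrite sqrtr_gt0 ltr0n.
have cs : c <= Num.sqrt n%:R.
  by rewrite -ler_sqr ?nnegrE ?sqrtr_ge0 ?cnorm_ge0// sqr_sqrtr.
rewrite -{1}(@sqr_sqrtr _ (n%:R : R))// expr2 invfM -mulrA.
rewrite mulrC ler_wpM2r ?invr_ge0 ?(ltW s0)//.
by rewrite ler_pdivrMl//; nra.
Qed.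

(** The estimate is uniform in [j >= n], so that [j] can later tend to infinity while [n] stays
    fixed. *)
Definition acentral (Z : nat -> nat -> A) := forall x e, 0 < e ->
  exists n0 : nat, forall n j, (n0 <= n)%N -> (n <= j)%N ->
    cnorm (x * Z n j - Z n j * x) < e.

Hypothesis genT : generated_by T.

Lemma inv_sqrt_lt e : 0 < e -> exists n0 : nat, forall n, (n0 <= n)%N ->
  2 / Num.sqrt (n%:R : R) < e.
Proof.
move=> e0; exists (Num.truncn ((2 / e) ^+ 2)).+1 => n nn.
have h : (2 / e) ^+ 2 < n%:R.
  by apply: lt_le_trans (truncnS_gt _) _; rewrite ler_nat.
have n0 : 0 < (n%:R : R) by rewrite (le_lt_trans _ h)// sqr_ge0.
have s0 : 0 < Num.sqrt (n%:R : R) by rewrite sqrtr_gt0.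
rewrite ltr_pdivrMr// mulrC -ltr_pdivrMr//.
by rewrite -ltr_sqr ?nnegrE ?divr_ge0 ?(ltW s0) ?(ltW e0)// sqr_sqrtr// ltW.
Qed.

(** Since [Z] is bounded, the elements that asymptotically commute with it form a closed subalgebra,
    by the Leibniz rule for commutators. It remains to test the generators and their adjoints. *)
Lemma acentral_gen (Z : nat -> nat -> A) :
  (forall n j, (0 < n)%N -> (n <= j)%N -> cnorm (Z n j) <= 1) ->
  (forall n j i, (i < n)%N -> (n <= j)%N ->
    cnorm (T i * Z n j - Z n j * T i) <= 2 / Num.sqrt n%:R) ->
  (forall n j i, (i < n)%N -> (n <= j)%N ->
    cnorm (star (T i) * Z n j - Z n j * star (T i)) <= 2 / Num.sqrt n%:R) ->
  acentral Z.
Proof.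
move=> nZ cT csT.
pose C := [set x | forall e, 0 < e ->
  exists n0 : nat, forall n j, (n0 <= n)%N -> (n <= j)%N ->
    cnorm (x * Z n j - Z n j * x) < e].
have C1 : C 1 by move=> e e0; exists 0%N => n j _ _; rewrite mul1r mulr1 subrr cnorm0.
have Clin (c : R[i]) x y : C x -> C y -> C (c *: x + y).
  move=> Cx Cy e e0; set k := Normc.normc c.
  have k0 : 0 <= k := normc_ge0 c.
  have k1 : 0 < k + 1 by rewrite ltr_wpDl.
  have [n1 H1] := Cx (e / 2 / (k + 1)) (ltac:(by rewrite !divr_gt0)).
  have [n2 H2] := Cy (e / 2) (ltac:(by rewrite divr_gt0)).
  exists (maxn n1 n2) => n j; rewrite geq_max => /andP[/H1{}H1 /H2{}H2] nj.
  have h2 := H2 _ nj; have := H1 _ nj; rewrite ltr_pdivlMr// => h1.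
  have -> : (c *: x + y) * Z n j - Z n j * (c *: x + y) =
      c *: (x * Z n j - Z n j * x) + (y * Z n j - Z n j * y).
    by rewrite mulrDl mulrDr -scalerAl -scalerAr scalerBr opprD addrACA.
  apply: (le_lt_trans (cnormD_le _ _)); rewrite cnormZ -/k.
  have := cnorm_ge0 (x * Z n j - Z n j * x); nra.
have Cmul x y : C x -> C y -> C (x * y).
  move=> Cx Cy e e0; set kx := cnorm x; set ky := cnorm y.
  have x0 : 0 <= kx := cnorm_ge0 x; have y0 : 0 <= ky := cnorm_ge0 y.
  have x1 : 0 < kx + 1 by rewrite ltr_wpDl.
  have y1 : 0 < ky + 1 by rewrite ltr_wpDl.
  have [n1 H1] := Cx (e / 2 / (ky + 1)) (ltac:(by rewrite !divr_gt0)).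
  have [n2 H2] := Cy (e / 2 / (kx + 1)) (ltac:(by rewrite !divr_gt0)).
  exists (maxn n1 n2) => n j; rewrite geq_max => /andP[/H1{}H1 /H2{}H2] nj.
  have := H2 _ nj; rewrite ltr_pdivlMr// => h2.
  have := H1 _ nj; rewrite ltr_pdivlMr// => h1.
  have -> : (x * y) * Z n j - Z n j * (x * y) =
      x * (y * Z n j - Z n j * y) + (x * Z n j - Z n j * x) * y.
    by rewrite mulrBr mulrBl !mulrA addrA subrK.
  apply: (le_lt_trans (cnormD_le _ _)).
  have := cnormM_le x (y * Z n j - Z n j * y).
  have := cnormM_le (x * Z n j - Z n j * x) y.
  have := cnorm_ge0 (x * Z n j - Z n j * x).
  have := cnorm_ge0 (y * Z n j - Z n j * y).
  rewrite -/kx -/ky; nra.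
have Ccl x : (forall e, 0 < e -> exists2 y, C y & cnorm (x - y) < e) -> C x.
  move=> H e e0; have [y Cy xy] := H (e / 3) (ltac:(by rewrite divr_gt0)).
  have [n0 Hn] := Cy (e / 3) (ltac:(by rewrite divr_gt0)).
  (* The successor makes [n] positive, as the bound [nZ] requires. *)
  exists n0.+1 => n j nn nj; have {}Hn := Hn _ _ (ltnW nn) nj.
  have -> : x * Z n j - Z n j * x =
      ((x - y) * Z n j - Z n j * (x - y)) + (y * Z n j - Z n j * y).
    rewrite mulrBl mulrBr opprB addrACA subrK.
    by rewrite [Z n j * y - _ - _]addrAC subrr sub0r.
  apply: (le_lt_trans (cnormD_le _ _)).
  have := cnormB_le ((x - y) * Z n j) (Z n j * (x - y)).
  have nz := nZ _ _ (leq_ltn_trans (leq0n _) nn) nj.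
  have := le_trans (cnormM_le (x - y) (Z n j)) (ler_piMr (cnorm_ge0 _) nz).
  have := le_trans (cnormM_le (Z n j) (x - y)) (ler_piMl (cnorm_ge0 _) nz).
  lra.
apply: (generated_ind genT C1 Clin Cmul Ccl) => i;
  move=> e /inv_sqrt_lt[n0 H]; exists (maxn n0 i.+1) => n j;
  rewrite geq_max => /andP[/H{}H ni] nj; apply: le_lt_trans H.
- exact: cT.
- exact: csT.
Qed.

Lemma avg_shift_acentral : acentral avg_shift.
Proof.
apply: acentral_gen => [n j n0 nj|n j i ni nj|n j i ni nj]; first exact: cnorm_avg_shift.
- have n0 : (0 < n)%N := leq_ltn_trans (leq0n _) ni.
  rewrite -(endo_mulT orthT _ ni) -mulrBl.
  apply: le_trans (avg_shift_comm n0 nj).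
  rewrite (le_trans (cnormM_le _ _))// cnormB.
  by rewrite ler_piMr ?cnorm_ge0// cnorm_isom.
- have n0 : (0 < n)%N := leq_ltn_trans (leq0n _) ni.
  rewrite -(starT_mul_endo orthT _ ni) -mulrBr.
  apply: le_trans (avg_shift_comm n0 nj).
  rewrite (le_trans (cnormM_le _ _))//.
  by rewrite ler_piMl ?cnorm_ge0// cnorm_star cnorm_isom.
Qed.

Lemma avg_fock_acentral : acentral avg_fock.
Proof.
apply: acentral_gen => [n j n0 nj|n j i ni nj|n j i ni nj]; first exact: cnorm_avg_fock.
- have n0 : (0 < n)%N := leq_ltn_trans (leq0n _) ni.
  rewrite -(endo_mulT orthT _ ni) -mulrBl -opprB avg_fock_sub_shift// opprB mulrBl.
  rewrite -mulrA defect_mulT// mulr0 subr0.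
  apply: le_trans (cnorm_avg_fock_error n0 nj).
  rewrite (le_trans (cnormM_le _ _))//.
  by rewrite ler_piMr ?cnorm_ge0// cnorm_isom.
- have n0 : (0 < n)%N := leq_ltn_trans (leq0n _) ni.
  rewrite -(starT_mul_endo orthT _ ni) -mulrBr avg_fock_sub_shift// mulrBr.
  rewrite mulrA orthT ltn_eqF ?(leq_trans ni)// mul0r sub0r cnormN.
  apply: le_trans (cnorm_avg_fock_error n0 nj).
  rewrite (le_trans (cnormM_le _ _))//.
  by rewrite ler_piMl ?cnorm_ge0// cnorm_star cnorm_isom.
Qed.

End CuntzInfinityCentral.

(** * Compressions by the isometries and vanishing of proper ideals *)

Section CuntzInfinitySimple.
Context {R : realType} {A : cstarType R} (T : nat -> A).
Hypothesis orthT : forall i j, star (T i) * T j = (i == j)%:R.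
Hypothesis genT : generated_by T.
Implicit Types (a b x y z X Y : A) (e : R).

Definition cvg_to0 (u : nat -> A) := forall e, 0 < e ->
  exists n0 : nat, forall n, (n0 <= n)%N -> cnorm (u n) < e.

Lemma cvg_to0D u v : cvg_to0 u -> cvg_to0 v -> cvg_to0 (fun n => u n + v n).
Proof.
move=> u0 v0 e e0.
have [n1 H1] := u0 (e / 2) (ltac:(by rewrite divr_gt0)).
have [n2 H2] := v0 (e / 2) (ltac:(by rewrite divr_gt0)).
exists (maxn n1 n2) => n; rewrite geq_max => /andP[/H1{}H1 /H2{}H2].
by rewrite (le_lt_trans (cnormD_le _ _))// [ltRHS]splitr ltrD.
Qed.

Lemma cvg_to0_mull b u : cvg_to0 u -> cvg_to0 (fun n => b * u n).
Proof.
move=> u0 e e0; have b1 : 0 < cnorm b + 1 by rewrite ltr_wpDl ?cnorm_ge0.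
have [n1 H1] := u0 (e / (cnorm b + 1)) (ltac:(by rewrite divr_gt0)).
exists n1 => n /H1; rewrite ltr_pdivlMr// => h.
rewrite (le_lt_trans (cnormM_le _ _))//; have := cnorm_ge0 (u n); nra.
Qed.

Lemma cvg_to0_mulr b u : cvg_to0 u -> cvg_to0 (fun n => u n * b).
Proof.
move=> u0 e e0; have b1 : 0 < cnorm b + 1 by rewrite ltr_wpDl ?cnorm_ge0.
have [n1 H1] := u0 (e / (cnorm b + 1)) (ltac:(by rewrite divr_gt0)).
exists n1 => n /H1; rewrite ltr_pdivlMr// => h.
rewrite (le_lt_trans (cnormM_le _ _))//; have := cnorm_ge0 (u n); nra.
Qed.

(** The adjoint of [T i_1 * ... * T i_k], which explains the reversed order of the factors. *)
Fixpoint star_word (w : seq nat) : A :=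
  if w is i :: w' then star_word w' * star (T i) else 1.

(** The scalar may depend on [e], so no limit of scalars has to be constructed. *)
Definition cvg_to_scalar (u : nat -> A) := forall e, 0 < e ->
  exists (c : R[i]) (n0 : nat), forall n, (n0 <= n)%N -> cnorm (u n - c *: 1) < e.

Lemma cvg_to_scalar_comb (k : R[i]) u v :
  cvg_to_scalar u -> cvg_to_scalar v -> cvg_to_scalar (fun n => k *: u n + v n).
Proof.
move=> Hu Hv e e0; have k0 : 0 <= Normc.normc k := normc_ge0 k.
have k1 : 0 < Normc.normc k + 1 by rewrite ltr_wpDl.
have [c [n1 H1]] := Hu (e / 2 / (Normc.normc k + 1)) (ltac:(by rewrite !divr_gt0)).
have [d [n2 H2]] := Hv (e / 2) (ltac:(by rewrite divr_gt0)).
exists (k * c + d), (maxn n1 n2) => n; rewrite geq_max => /andP[/H1{}H1 /H2{}H2].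
rewrite scalerDl -scalerA opprD addrACA -scalerBr.
rewrite (le_lt_trans (cnormD_le _ _))// cnormZ.
move: H1; rewrite ltr_pdivlMr// => h1.
have := cnorm_ge0 (u n - c *: 1); nra.
Qed.

Lemma cvg_to_scalar0 u n0 : (forall n, (n0 <= n)%N -> u n = 0) -> cvg_to_scalar u.
Proof.
by move=> H e e0; exists 0, n0 => n /H ->; rewrite scale0r subrr cnorm0.
Qed.

(* The limit is the vacuum state of [b]; in the set [M], the words are there to
   make the condition stable under multiplication by [star (T i)]. *)
Lemma compression_cvg_to_scalar b : cvg_to_scalar (fun j => star (T j) * b * T j).
Proof.
pose M := [set b | forall w, cvg_to_scalar (fun j => star (T j) * star_word w * b * T j)].
have M1 : M 1.
  case=> [|i w] /=.
    move=> e e0; exists 1, 0%N => n _.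
    by rewrite !mulr1 orthT eqxx scale1r subrr cnorm0.
  apply: (@cvg_to_scalar0 _ i.+1) => n ni.
  by rewrite -!mulrA mul1r orthT ltn_eqF// !mulr0.
have Mlin (c : R[i]) x y : M x -> M y -> M (c *: x + y).
  move=> Mx My w e /(cvg_to_scalar_comb c (Mx w) (My w))[d [n0 H]].
  exists d, n0 => n /H; congr (cnorm (_ - _) < _).
  by rewrite mulrDr mulrDl -scalerAr -scalerAl.
(* A first letter [i] of the word cancels against [T i], and any other first letter gives 0. For the
   empty word, [star (T n) * T i = 0] as soon as [n > i]. *)
have MT i x : M x -> M (T i * x).
  move=> Mx [|k w] /=.
    apply: (@cvg_to_scalar0 _ i.+1) => n ni.
    by rewrite mulr1 mulrA orthT gtn_eqF// !mul0r.
  have [->|ki] := eqVneq k i.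
    move=> e /(Mx w)[d [n0 H]]; exists d, n0 => n /H; congr (cnorm (_ - _) < _).
    by rewrite !mulrA -(mulrA _ (star (T i))) orthT eqxx mulr1.
  apply: (@cvg_to_scalar0 _ 0) => n _.
  by rewrite !mulrA -(mulrA _ (star (T k))) orthT (negbTE ki) mulr0 !mul0r.
have MsT i x : M x -> M (star (T i) * x).
  move=> Mx w e /(Mx (i :: w))[d [n0 H]]; exists d, n0 => n /H; congr (cnorm (_ - _) < _).
  by rewrite /= !mulrA.
have Mcl x : (forall e, 0 < e -> exists2 y, M y & cnorm (x - y) < e) -> M x.
  move=> H w e e0.
  set k := cnorm (star_word w); have k0 : 0 <= k := cnorm_ge0 _.
  have k1 : 0 < k + 1 by rewrite ltr_wpDl.
  have [y My xy] := H (e / 2 / (k + 1)) (ltac:(by rewrite !divr_gt0)).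
  have [d [n0 Hn]] := My w (e / 2) (ltac:(by rewrite divr_gt0)).
  exists d, n0 => n /Hn h.
  apply: (le_lt_trans (cnorm_triangle (star (T n) * star_word w * y * T n) _ _)).
  rewrite [ltRHS]splitr ltrD// -mulrBl -mulrBr.
  apply: (le_lt_trans (cnormM_le _ _)).
  apply: (le_lt_trans (ler_piMr (cnorm_ge0 _) (cnorm_isom orthT _))).
  apply: (le_lt_trans (cnormM_le _ _)).
  have h' : cnorm (star (T n) * star_word w) <= k.
    apply: (le_trans (cnormM_le _ _)).
    by rewrite ler_piMl ?cnorm_ge0// cnorm_star cnorm_isom.
  apply: (le_lt_trans (ler_wpM2r (cnorm_ge0 _) h')).
  move: xy; rewrite ltr_pdivlMr//; have := cnorm_ge0 (x - y); nra.
(* Left multiplication by every [x] preserves [M], by induction on [x] from the generators; applied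
   to [1] in [M] this reaches every [b]. *)
have /(_ b 1 M1) : forall x y, M y -> M (x * y).
  apply: (generated_ind genT) => [y|c x z Mx Mz y My|x z Mx Mz y My|x H y My|i y|i y].
  - by rewrite mul1r.
  - by rewrite mulrDl -scalerAl; apply: Mlin; [exact: Mx|exact: Mz].
  - by rewrite -mulrA; apply/Mx/Mz.
  - apply: Mcl => e e0; have y1 : 0 < cnorm y + 1 by rewrite ltr_wpDl ?cnorm_ge0.
    have [z Hz xz] := H (e / (cnorm y + 1)) (ltac:(by rewrite divr_gt0)).
    exists (z * y); first exact: Hz.
    move: xz; rewrite ltr_pdivlMr// => xz.
    rewrite -mulrBl (le_lt_trans (cnormM_le _ _))//.
    have := cnorm_ge0 (x - z); nra.
  - exact: MT.
  - exact: MsT.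
move=> /(_ [::]) Hb e /Hb[d [n0 H]]; exists d, n0 => n /H.
by rewrite /= !mulr1.
Qed.

Section ProperIdeal.
Variable I : set A.
Hypothesis Imull : forall b a, I a -> I (b * a).
Hypothesis Imulr : forall b a, I a -> I (a * b).
Hypothesis I1 : ~ I 1.

Lemma proper_ideal_compression a : I a -> cvg_to0 (fun j => star (T j) * a * T j).
Proof.
move=> Ia e e0.
have [c [n0 H]] := compression_cvg_to_scalar a (ltac:(by rewrite divr_gt0) : 0 < e / 2).
exists n0 => n nn; have {}H := H _ nn.
have Iy : I (star (T n) * a * T n) by apply/Imulr/Imull.
move: Iy H; set y := star _ * _ * _ => Iy H.
(* Otherwise [c^-1 *: y] is at distance less than 1 from the unit, hence right invertible, and [1]
   lies in the ideal. *)
have ce : Normc.normc c <= e / 2.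
  rewrite leNgt; apply/negP => ec.
  have c0 : 0 < Normc.normc c by rewrite (lt_trans _ ec)// divr_gt0.
  have cn0 : c != 0 by apply/eqP => c0'; rewrite c0' Normc.normc0 ltxx in c0.
  have [z yz] : exists z, (c^-1 *: y) * z = 1.
    apply: right_inverse_near1.
    rewrite -[X in _ - X](scale1r 1) -[X in X *: 1](mulVf cn0) -scalerA -scalerBr.
    by rewrite cnormZ Normc.normcV ltr_pdivrMl// mulr1 (lt_trans H).
  by apply: I1; rewrite -yz -scalerAl scalerAr; apply: Imulr.
have -> : y = (y - c *: 1) + c *: 1 by rewrite subrK.
apply: (le_lt_trans (cnormD_le _ _)); rewrite cnormZ [ltRHS]splitr ltr_leD//.
by rewrite (le_trans _ ce)// ler_piMr ?normc_ge0 ?cnorm1_le1.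
Qed.

(* The families that are linear in [T j], with coefficients independent of [j]. *)
Inductive bimodule_span : (nat -> A) -> Prop :=
| Span_base : bimodule_span T
| Span_0 : bimodule_span (fun=> 0)
| Span_D u v : bimodule_span u -> bimodule_span v -> bimodule_span (fun j => u j + v j)
| Span_mull b u : bimodule_span u -> bimodule_span (fun j => b * u j)
| Span_mulr b u : bimodule_span u -> bimodule_span (fun j => u j * b).

Lemma cvg_to0_0 : cvg_to0 (fun=> 0).
Proof. by move=> e e0; exists 0%N => n _; rewrite cnorm0. Qed.

(** Coefficients adjacent to [a] are absorbed into the ideal, and outer ones multiply a sequence
    tending to 0; the inductions therefore range over all [a] in the ideal. *)
Lemma proper_ideal_span_compression a u v : I a ->
  bimodule_span u -> bimodule_span v -> cvg_to0 (fun j => star (u j) * a * v j).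
Proof.
move=> Ia Hu Hv.
have eq_to0 (s t : nat -> A) : cvg_to0 s -> s = t -> cvg_to0 t by move=> + <-.
have H : forall a, I a -> cvg_to0 (fun j => star (T j) * a * v j).
  elim: Hv => {v} [||v w _ IHv _ IHw|b v _ IHv|b v _ IHv] a' Ia'.
  - exact: proper_ideal_compression.
  - by apply: eq_to0 cvg_to0_0 _; apply/funext => j; rewrite mulr0.
  - by apply: eq_to0 (cvg_to0D (IHv _ Ia') (IHw _ Ia')) _; apply/funext => j; rewrite mulrDr.
  - by apply: eq_to0 (IHv _ (Imulr b Ia')) _; apply/funext => j; rewrite !mulrA.
  - by apply: eq_to0 (cvg_to0_mulr b (IHv _ Ia')) _; apply/funext => j; rewrite !mulrA.
elim: Hu a Ia => {u} [||u w _ IHu _ IHw|b u _ IHu|b u _ IHu] a Ia.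
- exact: H.
- by apply: eq_to0 cvg_to0_0 _; apply/funext => j; rewrite star0 !mul0r.
- apply: eq_to0 (cvg_to0D (IHu _ Ia) (IHw _ Ia)) _; apply/funext => j.
  by rewrite starD !mulrDl.
- apply: eq_to0 (IHu _ (Imull (star b) Ia)) _; apply/funext => j.
  by rewrite starM !mulrA.
- apply: eq_to0 (cvg_to0_mull (star b) (IHu _ Ia)) _; apply/funext => j.
  by rewrite starM !mulrA.
Qed.

Lemma span_sum n (u : 'I_n -> nat -> A) : (forall k, bimodule_span (u k)) ->
  bimodule_span (fun j => \sum_(k < n) u k j).
Proof.
elim: n u => [|n IH] u Hu.
  have -> : (fun j => \sum_(k < 0) u k j) = fun=> 0 by apply/funext => j; rewrite big_ord0.
  exact: Span_0.
have -> : (fun j => \sum_(k < n.+1) u k j) =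
    fun j => u ord0 j + \sum_(k < n) u (lift ord0 k) j.
  by apply/funext => j; rewrite big_ord_recl.
by apply: Span_D => //; exact: IH.
Qed.

Lemma spanZ (c : R[i]) u : bimodule_span u -> bimodule_span (fun j => c *: u j).
Proof.
move=> /(Span_mull (c *: 1)); congr bimodule_span; apply/funext => j.
by rewrite -scalerAl mul1r.
Qed.

Lemma span_iter_endo n k u : bimodule_span u ->
  bimodule_span (fun j => iter k (endo T n) (u j)).
Proof.
move=> Hu; elim: k => //= k IH; apply: span_sum => i.
by apply/Span_mulr/Span_mull.
Qed.

Lemma span_fock n m : bimodule_span (fun j => fock T n j m).
Proof. by apply: span_sum => k; apply: span_iter_endo; apply/Span_mulr/Span_base. Qed.

Lemma proper_ideal_eq0 a : I a -> a = 0.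
Proof.
move=> Ia; apply: cnorm_eq0P => e e0.
have e4 : 0 < e / 4 by rewrite divr_gt0.
have [n1 H1] := avg_shift_acentral orthT genT a e4.
have [n2 H2] := avg_fock_acentral orthT genT a e4.
(* First [n] is fixed to make the commutators small for all [j >= n]; only then is [j] taken large
   enough for the compressions. *)
pose n := maxn 1 (maxn n1 n2).
have n0 : (0 < n)%N by rewrite leq_max.
have /H1{}H1 : (n1 <= n)%N by rewrite !leq_max leqnn orbT.
have /H2{}H2 : (n2 <= n)%N by rewrite !leq_max leqnn !orbT.
have SU : bimodule_span (avg_shift T n).
  by apply: spanZ; apply: span_sum => k; exact/span_iter_endo/Span_base.
have SW : bimodule_span (avg_fock T n).
  by apply: spanZ; apply: span_sum => k; exact: span_fock.
have [n3 H3] := proper_ideal_span_compression Ia SU SU e4.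
have [n4 H4] := proper_ideal_span_compression Ia (span_fock n n) SW e4.
pose j := maxn n (maxn n3 n4).
have nj : (n <= j)%N by rewrite leq_max leqnn.
have /H3{}H3 : (n3 <= j)%N by rewrite !leq_max leqnn orbT.
have /H4{}H4 : (n4 <= j)%N by rewrite !leq_max leqnn !orbT.
have {}H1 := H1 _ nj; have {}H2 := H2 _ nj.
have nU := cnorm_avg_shift orthT n0 nj.
have nW := cnorm_fock orthT n nj.
have := avg_partition orthT n0 nj.
move: H1 H2 H3 H4 nU nW.
set U := avg_shift T n j; set W := fock T n j n; set V := avg_fock T n j.
move=> H1 H2 H3 H4 nU nW UW.
(* This is [star U * U + star W * V = 1] multiplied by [a] on the right; each of the four terms has
   norm below [e / 4]. *)
have -> : a = (star U * a * U - star U * (a * U - U * a)) +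
    (star W * a * V - star W * (a * V - V * a)).
  rewrite !mulrBr !mulrA !opprB.
  rewrite [star U * a * U + _]addrC subrK [star W * a * V + _]addrC subrK.
  by rewrite -mulrDl UW mul1r.
apply: (le_lt_trans (cnormD_le _ _)).
have := cnormB_le (star U * a * U) (star U * (a * U - U * a)).
have := cnormB_le (star W * a * V) (star W * (a * V - V * a)).
have sU : cnorm (star U * (a * U - U * a)) <= cnorm (a * U - U * a).
  by rewrite (le_trans (cnormM_le _ _))// ler_piMl ?cnorm_ge0// cnorm_star.
have sW : cnorm (star W * (a * V - V * a)) <= cnorm (a * V - V * a).
  by rewrite (le_trans (cnormM_le _ _))// ler_piMl ?cnorm_ge0// cnorm_star.
lra.
Qed.

End ProperIdeal.

End CuntzInfinitySimple.

(** The kernel is an ideal, and it is proper because [phi 1 = 1] is nonzero. *)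
Lemma cuntz_inf_hom_inj (R : realType) (A B : cstarType R) (T : nat -> A)
  (phi : A -> B) : is_cuntz_inf T -> is_unital_star_hom phi -> injective phi.
Proof.
move=> [[orthT _] genT _] [lin mul one _] x y xy.
have phi0 : phi 0 = 0.
  by have := lin (-1) 0 0; rewrite scaler0 addr0 scaleN1r addNr.
apply/eqP; rewrite -subr_eq0; apply/eqP.
apply: (@proper_ideal_eq0 _ _ _ orthT genT [set a | phi a = 0]) => /=.
- by move=> b a pa; rewrite mul pa mulr0.
- by move=> b a pa; rewrite mul pa mul0r.
- by rewrite one => /eqP; rewrite oner_eq0.
- by rewrite -scaleN1r addrC lin xy scaleN1r addNr.
Qed.

(** * Square summable functions and representations *)

Section SquareSummableInner.
Context {R : realType} {T : choiceType}.
Implicit Types (u v w : T -> R) (f g k : l2 R T).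

Let maxrBN (a : R) : Num.max a 0 - Num.max (- a) 0 = a.
Proof. by case: (leP a 0) => a0; case: (leP (- a) 0) => a0'; lra. Qed.

(** Positive parts are not additive. Instead [v + w] is written as the difference of two nonnegative
    summable functions, the sums of the positive and of the negative parts. *)
Lemma rsumD v w : summable [set: T] (EFin \o v) -> summable [set: T] (EFin \o w) ->
  rsum (fun t => v t + w t) = rsum v + rsum w.
Proof.
move=> sv sw.
have vp := summable_funepos sv; have vn := summable_funeneg sv.
have wp := summable_funepos sw; have wn := summable_funeneg sw.
have E : EFin \o (fun t => v t + w t) =
    fun t => (((EFin \o v)^\+ \+ (EFin \o w)^\+) t - ((EFin \o v)^\- \+ (EFin \o w)^\-) t)%E.
  apply/funext => t /=; rewrite !funeposE !funenegE/= -!EFin_max -!EFinD.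
  by congr (_%:E); rewrite opprD addrACA !maxrBN.
rewrite /rsum E esumB; last 4 first.
- exact: summableD.
- exact: summableD.
- by move=> t _; rewrite adde_ge0.
- by move=> t _; rewrite adde_ge0.
rewrite !esumD//.
have fin (a : T -> \bar R) : (forall t, 0 <= a t)%E -> summable [set: T] a ->
    \esum_(t in [set: T]) a t \is a fin_num.
  by move=> a0; rewrite summableE; under eq_esum do rewrite gee0_abs//.
rewrite -fineD ?fin_numB ?fin//.
by rewrite fin_num_oppeD ?fin// addeACA.
Qed.

Lemma rsum_single v t : (forall s, s != t -> v s = 0) -> rsum v = v t.
Proof.
move=> v0; have single (a : T -> \bar R) : (0 <= a t)%E -> (forall s, s != t -> a s = 0%E) ->
    \esum_(s in [set: T]) a s = a t.
  move=> a0 as0; rewrite -(esum_set1 a0) [RHS]esum_mkcond; apply: eq_esum => s _.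
  by case: ifPn => //; rewrite notin_setE => /eqP/as0.
rewrite /rsum !single//.
- by rewrite funeposE funenegE/= -!EFin_max -EFinB/= maxrBN.
- by move=> s /v0 e; rewrite funenegE/= e oppr0 maxxx.
- by move=> s /v0 e; rewrite funeposE/= e maxxx.
Qed.

(** The bound [a b <= a^2 + b^2] dominates the products; [p] stands for the real or the imaginary
    part. *)
Lemma summable_l2_mul f g (p : R[i] -> R) : (forall z, `|p z| <= Normc.normc z) ->
  summable [set: T] (EFin \o (fun t => p (f t * (g t)^*))).
Proof.
move=> hp; rewrite /summable.
apply: (@le_lt_trans _ _ (sqsum f + sqsum g)%E); last first.
  by rewrite (l2_sqsum f) (l2_sqsum g) -EFinD ltry.
rewrite /sqsum -esumD; [|by move=> t _; rewrite lee_fin sqr_ge0..].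
apply: le_esum => t _; rewrite /= -EFinD lee_fin (le_trans (hp _))//.
rewrite Normc.normcM.
have -> : Normc.normc (g t)^* = Normc.normc (g t) by case: (g t) => a b /=; rewrite sqrrN.
have := normc_ge0 (f t); have := normc_ge0 (g t).
have := sqr_ge0 (Normc.normc (f t) - Normc.normc (g t)).
set a := Normc.normc (f t); set b := Normc.normc (g t); nra.
Qed.

Lemma Re_le_normc (z : R[i]) : `|complex.Re z| <= Normc.normc z.
Proof. by case: z => a b /=; rewrite -sqrtr_sqr ler_wsqrtr// lerDl sqr_ge0. Qed.

Lemma Im_le_normc (z : R[i]) : `|complex.Im z| <= Normc.normc z.
Proof. by case: z => a b /=; rewrite -sqrtr_sqr ler_wsqrtr// lerDr sqr_ge0. Qed.

Lemma l2innerDr f g k : l2inner f (g + k) = l2inner f g + l2inner f k.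
Proof.
have E t : f t * ((g + k) t)^* = f t * (g t)^* + f t * (k t)^*.
  by rewrite -mulrDr -rmorphD.
rewrite /l2inner /csum.
under eq_fun do rewrite E raddfD; rewrite rsumD; last 2 first.
- exact: summable_l2_mul Re_le_normc.
- exact: summable_l2_mul Re_le_normc.
under [X in complex.Complex _ (rsum X)]eq_fun do rewrite E raddfD; rewrite rsumD//.
- exact: summable_l2_mul Im_le_normc.
- exact: summable_l2_mul Im_le_normc.
Qed.

Lemma l2inner_l2e f t : l2inner f (l2e t) = f t.
Proof.
rewrite /l2inner /csum !(@rsum_single _ t) /=.
- by rewrite eqxx rmorph1 mulr1; case: (f t).
- by move=> s st; rewrite (negbTE st) rmorph0 mulr0.
- by move=> s st; rewrite (negbTE st) rmorph0 mulr0.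
Qed.

Lemma normc_le_l2norm f t : Normc.normc (f t) <= l2norm f.
Proof.
rewrite -ler_sqr ?nnegrE ?normc_ge0 ?l2norm_ge0// l2norm_sqr -lee_fin -l2_sqsum.
rewrite -(@esum_set1 _ _ t (fun t => (Normc.normc (f t) ^+ 2)%:E)) ?lee_fin ?sqr_ge0//.
rewrite esum_mkcond; apply: le_esum => u _.
by case: ifP => // _; rewrite lee_fin sqr_ge0.
Qed.

End SquareSummableInner.

(** * Norm bound for representations and their action on coordinates *)

Section RepresentationBound.
Context {R : realType} {Omega : choiceType} {A : cstarType R}.
Variable pi : A -> l2 R Omega -> l2 R Omega.
Hypothesis pirep : is_representation pi.
Implicit Types (a b : A) (u v : l2 R Omega).

Lemma repD a b v : pi (a + b) v = pi a v + pi b v.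
Proof. by have := rep_linear pirep 1 a b v; rewrite !scale1r. Qed.

Lemma rep0 v : pi 0 v = 0.
Proof. by have := repD 0 0 v; rewrite addr0 -{1}[pi 0 v]addr0 => /addrI. Qed.

Lemma repZ (c : R[i]) a v : pi (c *: a) v = c *: pi a v.
Proof. by have := rep_linear pirep c a 0 v; rewrite rep0 !addr0. Qed.

Lemma repB a b v : pi (a - b) v = pi a v - pi b v.
Proof. by rewrite repD -scaleN1r repZ scaleN1r. Qed.

Lemma l2inner_rep_sqr a v : l2inner v (pi (star a * a) v) = (l2norm (pi a v) ^+ 2)%:C%C.
Proof. by rewrite (rep_mul pirep) -(rep_star pirep) l2inner_norm l2_normE rmorphXn. Qed.

Lemma rep_contraction a v : cnorm a < 1 -> l2norm (pi a v) <= l2norm v.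
Proof.
move=> a1; have [b hb] : exists b, 1 - star a * a = star b * b.
  apply: one_sub_star_mul_square; first by rewrite starM starK.
  by rewrite cstar_identity expr_lt1 ?cnorm_ge0.
(* The squared norm of [v] splits as that of [pi a v] plus that of [pi b v]. *)
have : l2inner v v = l2inner v (pi (star a * a) v) + l2inner v (pi (star b * b) v).
  by rewrite -l2innerDr -repD -hb addrC subrK (rep_one pirep).
rewrite !l2inner_rep_sqr l2inner_norm l2_normE -rmorphXn -rmorphD/= => /complexI e.
rewrite -ler_sqr ?nnegrE ?l2norm_ge0// e lerDl sqr_ge0//.
Qed.

Lemma rep_norm_le a v : l2norm (pi a v) <= cnorm a * l2norm v.
Proof.
(* Rescaling by [c] reduces to the contractive case; then [c] tends to [cnorm a]. *)
have H c : cnorm a < c -> l2norm (pi a v) <= c * l2norm v.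
  move=> ac; have c0 : 0 < c by rewrite (le_lt_trans _ ac) ?cnorm_ge0.
  have -> : pi a v = c%:C%C *: pi ((c^-1)%:C%C *: a) v.
    by rewrite -repZ scalerA -rmorphM/= mulfV ?gt_eqF// scale1r.
  rewrite l2normZ /= expr0n /= addr0 sqrtr_sqr (ger0_norm (ltW c0)).
  rewrite ler_pM2l// rep_contraction// cnormZr ?invr_ge0 ?(ltW c0)//.
  by rewrite ltr_pdivrMl// mulr1.
have v1 : 0 < l2norm v + 1 by rewrite ltr_wpDl ?l2norm_ge0.
apply/ler_addgt0Pr => e e0.
have := H (cnorm a + e / (l2norm v + 1)) (ltac:(by rewrite ltrDl divr_gt0)).
move/le_trans; apply; rewrite mulrDl lerD2l mulrAC ler_pdivrMr//.
by rewrite ler_wpM2l ?(ltW e0)// lerDl.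
Qed.

Section BasisMap.
Variables (a : A) (f : Omega -> Omega).
Hypothesis f_inj : injective f.
Hypothesis af : forall w, pi a (l2e w) = l2e (f w).

(** A coordinate is an inner product with a basis vector, so the action of [a] on the basis
    determines that of its adjoint on coordinates. *)
Lemma rep_star_coord v t : pi (star a) v t = v (f t).
Proof. by rewrite -l2inner_l2e (rep_star pirep) starK af l2inner_l2e. Qed.

Lemma rep_coord v t : pi a v (f t) = v t.
Proof.
rewrite -l2inner_l2e (rep_star pirep) -[RHS]l2inner_l2e; congr l2inner.
apply/val_inj/funext => s; rewrite [LHS]rep_star_coord /=.
by rewrite (inj_eq f_inj).
Qed.

(** The adjoint kills the basis vectors outside the range of [f]. *)
Lemma rep_coord_notin v t : ~ range f t -> pi a v t = 0.
Proof.
move=> ft; rewrite -l2inner_l2e (rep_star pirep).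
have -> : pi (star a) (l2e t) = 0 *: l2e t.
  apply/val_inj/funext => s; rewrite scale0r [LHS]rep_star_coord /=.
  by case: eqP => // e; case: ft; exists s.
rewrite -[0 *: _](addrK (l2e t)) scale0r add0r subrr.
by have := l2innerDr v 0 0; rewrite addr0 -{1}[l2inner v 0]addr0 => /addrI.
Qed.

End BasisMap.

End RepresentationBound.

(** * Words and branching function systems *)

Section Words.
Context {Omega : choiceType} {J : eqType} (f : J -> Omega -> Omega).
Hypothesis bf : is_bfs f.
Variable E : set Omega.

Lemma word_map_inj w : injective (word_map f w).
Proof. by elim: w => //= i w IH x y /(bfs_inj bf)/IH. Qed.

(** The orbit of [f i x] is that of [x] delayed by one step, so the two sets of visiting times
    differ by a shift and possibly the time 0. *)
Lemma recurrent_bfs i x :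
  recurrent (bfs_map f) E (f i x) <-> recurrent (bfs_map f) E x.
Proof.
rewrite /recurrent/=; split; apply: contra_not => fin.
- apply: (@sub_finite_set _ _ ([set 0%N] `|` succn @` [set n | E (iter n (bfs_map f) x)])).
    case=> [|n]; first by left.
    by rewrite /= -iterS iterSr (bfs_mapK bf); right; exists n.
  by rewrite finite_setU; split=> //; exact: finite_image.
- apply: (@sub_finite_set _ _ (predn @` [set n | E (iter n (bfs_map f) (f i x))])).
    by move=> n /= En; exists n.+1; rewrite //= -iterS iterSr (bfs_mapK bf).
  exact: finite_image.
Qed.

Lemma recurrent_word_map w x :
  recurrent (bfs_map f) E (word_map f w x) <-> recurrent (bfs_map f) E x.
Proof. by elim: w => //= i w IH; rewrite recurrent_bfs. Qed.

End Words.

Section CuntzWords.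
Context {R : realType} {J : finType} {B : cstarType R} (S : J -> B).
Hypothesis orthS : forall i j, star (S i) * S j = (i == j)%:R.

Definition word_prod (w : seq J) : B := \prod_(i <- w) S i.

(** Only the last letter of such a word lies in [P], so no word is a proper prefix of another.
    Cancelling equal letters from the left ends at a mismatch unless the words agree. *)
Lemma word_prod_orth (P Q : set J) : P `&` Q = set0 -> forall w w' i i',
  P i -> P i' -> (forall k, k \in w -> Q k) -> (forall k, k \in w' -> Q k) ->
  star (word_prod (rcons w i)) * word_prod (rcons w' i') = (rcons w i == rcons w' i')%:R.
Proof.
rewrite /word_prod => PQ; have neq k l : P k -> Q l -> (k == l) = false.
  by move=> Pk Ql; apply/eqP => kl; have : (P `&` Q) k; [split=> //; rewrite kl|rewrite PQ].
elim=> [|a w IH] [|a' w'] i i' Pi Pi' Qw Qw' /=.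
- by rewrite !big_seq1 orthS eqseq_cons andbT.
- rewrite big_seq1 big_cons mulrA orthS eqseq_cons neq ?mul0r//.
  by apply: Qw'; rewrite mem_head.
- rewrite big_seq1 big_cons starM -mulrA orthS eqseq_cons eq_sym neq ?mulr0//.
  by apply: Qw; rewrite mem_head.
- rewrite !big_cons starM mulrA -(mulrA _ (star (S a))) orthS eqseq_cons.
  case: eqP => _; last by rewrite mulr0 mul0r.
  rewrite mulr1 IH// => k kw.
    by apply: Qw; rewrite in_cons kw orbT.
  by apply: Qw'; rewrite in_cons kw orbT.
Qed.

End CuntzWords.

(** The partial sum [e] of range projections is a projection, hence so is [1 - e], which is its own
    witness of positivity. *)
Lemma orth_isom_cuntz_inf (R : realType) (B : cstarType R) (t : nat -> B) :
  (forall i j, star (t i) * t j = (i == j)%:R) -> cuntz_inf_rel t.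
Proof.
move=> orth; split=> // n; set e := \sum_(j < n) _.
have se : star e = e by rewrite star_sum; apply: eq_bigr => i _; rewrite starM starK.
have ee : e * e = e.
  rewrite {1}/e mulr_suml; apply: eq_bigr => i _.
  rewrite mulr_sumr (bigD1 i)//= big1 ?addr0.
    by rewrite mulrA -(mulrA (t i)) orth eqxx mulr1.
  move=> k ki; rewrite mulrA -(mulrA (t i)) orth (_ : _ == _ = false) ?mulr0 ?mul0r//.
  by rewrite eq_sym; exact/negbTE.
by exists (1 - e); rewrite starB star1 se mulrBr mulr1 mulrBl mul1r ee subrr subr0.
Qed.

Section L2Subspace.
Context {R : realType} {T : choiceType} (V : set T).
Implicit Types (u v : l2 R T).

Lemma l2ext_in (f : l2 R V) (t : V) : l2ext V f (val t) = f t.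
Proof. by rewrite /= valK. Qed.

Lemma l2ext_notin (f : l2 R V) t : ~ V t -> l2ext V f t = 0.
Proof. by move=> Vt; rewrite /= insubN//; apply/negP => /set_mem. Qed.

Lemma l2sub_supportP u : l2sub V u <-> forall t, ~ V t -> u t = 0.
Proof.
split=> [[f _ <-] t|u0]; first exact: l2ext_notin.
have uV : (fun t : V => u (val t)) \in @sq_summable R V.
  rewrite -topredE/= /sq_summable; apply: le_lt_trans (valP u : (sqsum u < +oo)%E).
  have vV : set_inj [set: V] (val : V -> T) by move=> a b _ _; exact: val_inj.
  rewrite /sqsum -(@esum_image R _ _ _ _ (fun t => (Normc.normc (u t) ^+ 2)%:E) vV).
  rewrite esum_mkcond; apply: le_esum => t _.
  by case: ifP => // _; rewrite lee_fin sqr_ge0.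
exists (L2 uV) => //; apply/val_inj/funext => t.
have [Vt|Vt] := pselect (V t).
  by rewrite -[t]/(val (SigSub (mem_set Vt) : V)) [LHS]l2ext_in.
by rewrite [LHS]l2ext_notin//; exact/esym/u0.
Qed.

(** Each coordinate is bounded by the norm, so vanishing outside [V] passes to limits. *)
Lemma l2sub_closed : closed (l2sub V : set (l2 R T)).
Proof.
move=> u clu; apply/l2sub_supportP => t Vt; apply: Normc.eq0_normc; apply/eqP.
rewrite eq_le normc_ge0 andbT; apply/ler_addgt0Pr => e e0; rewrite add0r.
have e0' : 0 < (e%:C)%C :> R[i] by rewrite ltcR.
have [v [/l2sub_supportP/(_ _ Vt) vt]] := clu _ (nbhsx_ballx u _ e0').
rewrite -ball_normE /= l2_normE ltcR => uv.
have -> : u t = (u - v) t by rewrite -[RHS]/(u t - v t) vt subr0.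
by rewrite (le_trans (normc_le_l2norm _ _))// ltW.
Qed.

End L2Subspace.

(** * Passing from generators to the whole algebra *)

Section RepresentationClosure.
Context {R : realType} {Omega : choiceType} {A : cstarType R}.
Variable pi : A -> l2 R Omega -> l2 R Omega.
Hypothesis pirep : is_representation pi.

Lemma rep_coord_near (a b : A) e v t : cnorm (a - b) < e ->
  Normc.normc (pi a v t - pi b v t) <= e * l2norm v.
Proof.
move=> ab; rewrite -[X in Normc.normc X]/((pi a v - pi b v) t) -repB//.
rewrite (le_trans (normc_le_l2norm _ _))// (le_trans (rep_norm_le pirep _ _))//.
by rewrite ler_wpM2r ?l2norm_ge0// ltW.
Qed.

Lemma rep_invariant (J : Type) (s : J -> A) (V : set Omega) : generated_by s ->
  (forall j v, l2sub V v -> l2sub V (pi (s j) v)) ->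
  (forall j v, l2sub V v -> l2sub V (pi (star (s j)) v)) ->
  forall a v, l2sub V v -> l2sub V (pi a v).
Proof.
move=> gen Vs Vss.
pose C a := forall v, l2sub V v -> l2sub V (pi a v).
have Ccl a : (forall e, 0 < e -> exists2 b, C b & cnorm (a - b) < e) -> C a.
  move=> H v Vv; apply/l2sub_supportP => t Vt; apply: Normc.eq0_normc; apply/eqP.
  rewrite eq_le normc_ge0 andbT; apply/ler_addgt0Pr => e e0; rewrite add0r.
  have v1 : 0 < l2norm v + 1 by rewrite ltr_wpDl ?l2norm_ge0.
  have [b Cb ab] := H (e / (l2norm v + 1)) (ltac:(by rewrite divr_gt0)).
  have /l2sub_supportP/(_ _ Vt) bt := Cb _ Vv.
  have := rep_coord_near v t ab; rewrite bt subr0 => /le_trans; apply.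
  by rewrite mulrAC ler_pdivrMr// ler_wpM2l ?(ltW e0)// lerDl.
have Clin (c : R[i]) a b : C a -> C b -> C (c *: a + b).
  move=> Ca Cb v Vv; apply/l2sub_supportP => t Vt; rewrite (rep_linear pirep).
  have /l2sub_supportP/(_ _ Vt) at0 := Ca _ Vv.
  have /l2sub_supportP/(_ _ Vt) bt0 := Cb _ Vv.
  by rewrite -[LHS]/(c * pi a v t + pi b v t) at0 bt0 mulr0 addr0.
have Cmul a b : C a -> C b -> C (a * b).
  by move=> Ca Cb v Vv; rewrite (rep_mul pirep); apply/Ca/Cb.
apply: (generated_ind gen _ Clin Cmul Ccl) => //.
by move=> v; rewrite (rep_one pirep).
Qed.

Lemma rep_restriction (J : Type) (s : J -> A) (V : set Omega)
    (pi' : A -> l2 R V -> l2 R V) : is_representation pi' -> generated_by s ->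
  (forall j v, pi (s j) (l2ext V v) = l2ext V (pi' (s j) v)) ->
  (forall j v, pi (star (s j)) (l2ext V v) = l2ext V (pi' (star (s j)) v)) ->
  forall a v, pi a (l2ext V v) = l2ext V (pi' a v).
Proof.
move=> pirep' gen Hs Hss.
pose C a := forall v, pi a (l2ext V v) = l2ext V (pi' a v).
have extlin (c : R[i]) (u v : l2 R V) : l2ext V (c *: u + v) = c *: l2ext V u + l2ext V v.
  apply/val_inj/funext => t; rewrite -[RHS]/(c * l2ext V u t + l2ext V v t).
  have [Vt|Vt] := pselect (V t); last by rewrite [LHS]l2ext_notin// !l2ext_notin// mulr0 addr0.
  by rewrite -[t]/(val (SigSub (mem_set Vt) : V)) [LHS]l2ext_in !l2ext_in.
have Ccl a : (forall e, 0 < e -> exists2 b, C b & cnorm (a - b) < e) -> C a.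
  move=> H v; apply/val_inj/funext => t; apply/eqP; rewrite -subr_eq0; apply/eqP.
  apply: Normc.eq0_normc; apply/eqP.
  rewrite eq_le normc_ge0 andbT; apply/ler_addgt0Pr => e e0; rewrite add0r.
  pose m := l2norm (l2ext V v) + l2norm v.
  have m0 : 0 <= m by rewrite addr_ge0 ?l2norm_ge0.
  have m1 : 0 < m + 1 by rewrite ltr_wpDl.
  have [b Cb ab] := H (e / (m + 1)) (ltac:(by rewrite divr_gt0)).
  have h1 := rep_coord_near (l2ext V v) t ab.
  have h2 : Normc.normc (l2ext V (pi' b v) t - l2ext V (pi' a v) t) <= e / (m + 1) * l2norm v.
    have [Vt|Vt] := pselect (V t); last first.
      by rewrite !l2ext_notin// subrr Normc.normc0 mulr_ge0 ?l2norm_ge0// divr_ge0 ?ltW.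
    rewrite -[t]/(val (SigSub (mem_set Vt) : V)) !l2ext_in.
    rewrite -[X in Normc.normc X]/((pi' b v - pi' a v) _) -repB//.
    rewrite (le_trans (normc_le_l2norm _ _))// (le_trans (rep_norm_le pirep' _ _))//.
    by rewrite ler_wpM2r ?l2norm_ge0// cnormB ltW.
  (* Both representations agree on the approximant [b], which leaves one approximation error on each
     side. *)
  have -> : val (pi a (l2ext V v)) t - val (l2ext V (pi' a v)) t =
      (pi a (l2ext V v) t - pi b (l2ext V v) t) + (l2ext V (pi' b v) t - l2ext V (pi' a v) t).
    by rewrite -Cb addrA subrK.
  apply: (le_trans (le_normcD _ _)); apply: (le_trans (lerD h1 h2)).
  by rewrite -mulrDr -/m mulrAC ler_pdivrMr// ler_wpM2l ?(ltW e0)// lerDl.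
have Clin (c : R[i]) a b : C a -> C b -> C (c *: a + b).
  by move=> Ca Cb v; rewrite (rep_linear pirep) (rep_linear pirep') Ca Cb extlin.
have Cmul a b : C a -> C b -> C (a * b).
  by move=> Ca Cb v; rewrite (rep_mul pirep) (rep_mul pirep') Cb Ca.
apply: (generated_ind gen _ Clin Cmul Ccl) => //.
by move=> v; rewrite (rep_one pirep) (rep_one pirep').
Qed.

End RepresentationClosure.

(** * The embedding *)

(** The argument takes place for branching function systems; a slow continued fraction algorithm
    enters through [scfa_bfs]. *)
Lemma bfs_jump_embedding (R : realType) (Omega : choiceType) (J : finType)
  (f : J -> Omega -> Omega) (E : set Omega) (bf : is_bfs f)
  (g : nat -> recurrent (bfs_map f) E -> recurrent (bfs_map f) E)
  (g_inj : injective g) (g_branch : forall m, inverse_branches f E (g m))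
  (B : cstarType R) (S : J -> B)
  (orthS : forall i j, star (S i) * S j = (i == j)%:R) (genS : generated_by S)
  (A : cstarType R) (T : nat -> A) (cuntzT : is_cuntz_inf T)
  (piF : B -> l2 R Omega -> l2 R Omega) (hF : is_induced_representation S f piF)
  (piG : A -> l2 R (recurrent (bfs_map f) E) -> l2 R (recurrent (bfs_map f) E))
  (hG : is_induced_representation T g piG) :
  exists phi : A -> B,
    [/\ is_unital_embedding phi,
        is_closed_invariant_subspace piF (l2sub (recurrent (bfs_map f) E))
      & forall (a : A) (v : l2 R (recurrent (bfs_map f) E)),
          piF (phi a) (l2ext _ v) = l2ext _ (piG a v)].
Proof.
set V := recurrent (bfs_map f) E.
(* An empty set has a single self-map, against injectivity of [g]. The point obtained shows that
   ranges are nonempty, so none is both inside [E] and disjoint from it. *)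
have [x0 _] : exists x : V, True.
  apply: contrapT => noV; have : g 0%N = g 1%N by apply/funext => x; case: noV; exists x.
  by move/g_inj.
pose w0 := val x0.
have [repF SF] := hF; have [repG TG] := hG.
have /choice[wi wiP] : forall m, exists p : seq J * J,
    [/\ range (f p.2) `<=` E, forall i', i' \in p.1 -> range (f i') `&` E = set0
      & forall x, val (g m x) = word_map f (rcons p.1 p.2) (val x)].
  by move=> m; have [w [i [h1 h2 h3]]] := g_branch m; exists (w, i).
pose w m := rcons (wi m).1 (wi m).2.
have gE m x : val (g m x) = word_map f (w m) (val x) by have [_ _] := wiP m.
have w_inj : injective w.
  by move=> m n mn; apply/g_inj/funext => x; apply/val_inj; rewrite !gE mn.
have orthw m n : star (word_prod S (w m)) * word_prod S (w n) = (m == n)%:R.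
  rewrite -(inj_eq w_inj).
  have [wE wN _] := wiP m; have [wE' wN' _] := wiP n.
  apply: (word_prod_orth orthS (P := [set i | range (f i) `<=` E])
    (Q := [set i | range (f i) `&` E = set0])) => //.
  rewrite -subset0 => i [/= iE iN].
  have : (range (f i) `&` E) (f i w0) by split; [exists w0|apply: iE; exists w0].
  by rewrite iN.
have [phi [phom phiT]] := univ_ext cuntzT (orth_isom_cuntz_inf orthw).
exists phi; split.
- by split=> //; exact: cuntz_inf_hom_inj cuntzT phom.
- split.
  + by apply/l2sub_supportP => t _.
  + move=> c u v /l2sub_supportP u0 /l2sub_supportP v0; apply/l2sub_supportP => t Vt.
    by rewrite -[LHS]/(c * u t + v t) u0// v0// mulr0 addr0.
  + exact: l2sub_closed.
  (* [S i] and its adjoint move coordinates along [f i] and back, and [x] is recurrent exactly when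
     [f i x] is. *)
  + apply: (rep_invariant repF genS) => i v /l2sub_supportP v0;
      apply/l2sub_supportP => t Vt.
      have [[s _ st]|nr] := pselect (range (f i) t); last first.
        exact: (rep_coord_notin repF (SF i) _ nr).
      rewrite -st (rep_coord repF (@bfs_inj _ _ _ bf i) (SF i)) v0// => Vs.
      by apply: Vt; rewrite -st; apply/recurrent_bfs.
    by rewrite (rep_star_coord repF (SF i)) v0// => /(recurrent_bfs bf).
(* [piF \o phi] represents [Oinf] on the large space, with [T m] acting on the basis by the word map
   of [w m]; it is compared with [piG] on the generators. *)
- have repFp : is_representation (piF \o phi).
    split=> /=.
    + by move=> a; exact: (rep_op_linear repF).
    + by move=> a; exact: (rep_op_bounded repF).
    + by move=> c a b v; rewrite (ush_linear phom) (rep_linear repF).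
    + by move=> a b v; rewrite (ush_mul phom) (rep_mul repF).
    + by move=> v; rewrite (ush_one phom) (rep_one repF).
    + by move=> a u v; rewrite (rep_star repF) (ush_star phom).
  have SW m x : (piF \o phi) (T m) (l2e x) = l2e (word_map f (w m) x).
    rewrite /= phiT /word_prod; elim: (w m) => [|i u IH] /=.
      by rewrite big_nil (rep_one repF).
    by rewrite big_cons (rep_mul repF) IH SF.
  have gm_inj m : injective (g m).
    by move=> x y /(congr1 val); rewrite !gE => /(word_map_inj bf)/val_inj.
  have Vw m x : V (word_map f (w m) x) <-> V x := recurrent_word_map bf E (w m) x.
  have VP t : V t -> exists x : V, val x = t by move=> Vt; exists (SigSub (mem_set Vt)).
  apply: (rep_restriction repFp repG (univ_gen cuntzT)) => m v;
    apply/val_inj/funext => t.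
  (* On the range of the word map both sides equal the coordinate of [v] at the preimage, or 0 if
     this is not recurrent; off the range both vanish. *)
  + have [[s _ <-]|nr] := pselect (range (word_map f (w m)) t).
      rewrite [LHS](rep_coord repFp (@word_map_inj _ _ _ bf (w m)) (SW m)).
      have [/VP[x <-]|Vs] := pselect (V s); last first.
        by rewrite [LHS]l2ext_notin// [RHS]l2ext_notin// => /Vw.
      by rewrite [LHS]l2ext_in -gE [RHS]l2ext_in (rep_coord repG (@gm_inj m) (TG m)).
    rewrite [LHS](rep_coord_notin repFp (SW m) _ nr).
    have [/VP[x xt]|Vt] := pselect (V t); last by rewrite [RHS]l2ext_notin.
    rewrite -xt [RHS]l2ext_in (rep_coord_notin repG (TG m))// => -[y _ yx].
    by apply: nr; exists (val y); rewrite // -gE yx.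
  + rewrite [LHS](rep_star_coord repFp (SW m)).
    have [/VP[x <-]|Vt] := pselect (V t); last first.
      by rewrite [LHS]l2ext_notin ?[RHS]l2ext_notin// => /Vw.
    by rewrite -gE l2ext_in [RHS]l2ext_in (rep_star_coord repG (TG m)).
Qed.

Theorem theorem2 (R : realType) (N : nat) (h : scfa R N) (j k : 'I_N) (E : set (Irr R))
  (hjk : (j <= k)%N)
  (hE : E = \bigcup_(i in [set i : 'I_N | (j <= i <= k)%N]) range (scfa_map h i))
  (hEI : E <> setT)
  (g : nat -> recurrent (bfs_map (scfa_map h)) E -> recurrent (bfs_map (scfa_map h)) E)
  (hg_inj : injective g)
  (hg_range : range g = inverse_branches (scfa_map h) E)
  (ON : cstarType R) (S : 'I_N -> ON) (hS : is_cuntz S)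
  (Oinf : cstarType R) (T : nat -> Oinf) (hT : is_cuntz_inf T)
  (piF : ON -> l2 R (Irr R) -> l2 R (Irr R))
  (hpiF : is_induced_representation S (scfa_map h) piF)
  (piG : Oinf -> l2 R (recurrent (bfs_map (scfa_map h)) E) ->
                 l2 R (recurrent (bfs_map (scfa_map h)) E))
  (hpiG : is_induced_representation T g piG) :
  exists phi : Oinf -> ON,
    [/\ is_unital_embedding phi,
        is_closed_invariant_subspace piF
          (l2sub (recurrent (bfs_map (scfa_map h)) E))
      & forall (a : Oinf) (v : l2 R (recurrent (bfs_map (scfa_map h)) E)),
          piF (phi a) (l2ext _ v) = l2ext _ (piG a v)].
Proof.
have [orthS _] := univ_rel hS.
apply: (bfs_jump_embedding (scfa_bfs h) hg_inj _ orthS (univ_gen hS) hT hpiF hpiG).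
by move=> m; rewrite -hg_range; exists m.
Qed.
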